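(* Let $0<T<\infty$. For any $\delta>0$ and any positive integer $m\ge1$, there exists a finite positive constant $C(\delta,m)$ (which only depends on $\delta$ and $m$) such that $$\sup_{k\ge1}\ \mathbb{E}\sup_{0\le t\le T}\|U^k(t)\|^{2+\delta}_{I_m;2+\delta}\ \le\ \mathbb{E}\sup_{0\le t\le T}\|\ell(t)\|^{2+\delta}_{I_m;2+\delta}+C(\delta,m)\,T^{\frac12+\frac{\delta}{4}} .$$ Here $U^k(t)$ denotes the function $x\mapsto U^k(t,x)$ (normalized number of upcrossings of the embedded random walk at scale $2^{-k}$), $\ell(t)$ denotes the function $x\mapsto\ell^x(t)$ (Brownian local time), $I_m=[-2^m,2^m]$, $\|\cdot\|^q_{I_m;q}$ is the $q$-variation over $I_m$, and $\mathbb{E}$ is expectation under the Wiener measure $\mathbb{P}$ with $B(0)=0$; all are defined in the context.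
   Context: Let $\Omega=C([0,+\infty);\mathbb{R})$, $B(\omega,t)=\omega(t)$ the canonical Brownian motion, and $\mathbb{P}$ the Wiener measure with $\mathbb{P}\{B(0)=0\}=1$; $\mathbb{E}$ is expectation under $\mathbb{P}$. Local time: $\{\ell^x(t);(x,t)\in\mathbb{R}\times[0,\infty)\}$ is the jointly continuous version of the density with respect to Lebesgue measure of the occupation measure $\mu_t(A)=\int_0^t 1_A(B(s))\,ds$, $A$ Borel in $\mathbb{R}$. Embedded random walk: for each integer $k\ge1$ let $T^k_0:=0$ and $T^k_n:=\inf\{T^k_{n-1}<t<\infty;\ |B(t)-B(T^k_{n-1})|=2^{-k}\}$ for $n\ge1$. Let $\eta^k_n:=1$ if $B(T^k_n)-B(T^k_{n-1})=2^{-k}$ and $T^k_n<\infty$, $\eta^k_n:=-1$ if $B(T^k_n)-B(T^k_{n-1})=-2^{-k}$ and $T^k_n<\infty$, and $\eta^k_n:=0$ if $T^k_n=\infty$. Define $$A^k(t):=\sum_{n=1}^\infty 2^{-k}\eta^k_n 1_{\{T^k_n\le t\}},\qquad N^k(t):=\max\{n;\ T^k_n\le t\},\qquad t\ge0.$$ Upcrossings: for $x\in\mathbb{R}$ let $j_k(x)$ be the unique integer with $(j_k(x)-1)2^{-k}<x\le j_k(x)2^{-k}$, and let $$u(j_k(x)2^{-k},k,t):=\#\Big\{n\in\{0,\ldots,N^k(t)-1\};\ A^k(T^k_n)=(j_k(x)-1)2^{-k},\ A^k(T^k_{n+1})=j_k(x)2^{-k}\Big\},$$ $$U^k(t,x):=2\cdot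 2^{-k}\,u(j_k(x)2^{-k},k,t),\qquad (t,x)\in[0,+\infty)\times\mathbb{R}.$$ Variation: for a positive integer $m$, $I_m:=[-2^m,2^m]$, and for $f:I_m\to\mathbb{R}$ and $1\le q<\infty$, $$\|f\|^q_{I_m;q}:=\sup_{\Pi}\sum_{x_i\in\Pi}|f(x_i)-f(x_{i-1})|^q,$$ where the supremum is over all partitions $\Pi$ of $I_m$. *)

(* Defs.v *)
From HB Require Import structures.
From mathcomp Require Import all_boot all_order all_algebra.
From mathcomp Require Import all_classical all_reals all_analysis.

Set Implicit Arguments.
Unset Strict Implicit.
Unset Printing Implicit Defensive.

Import Order.TTheory GRing.Theory Num.Theory.
Import numFieldNormedType.Exports.

Local Open Scope classical_set_scope.
Local Open Scope ring_scope.

Section path_space.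
Variable R : realType.

Definition half_line : Type := [set` `[(0 : R), +oo[].

Lemma zero_in_half_line : (0 : R) \in [set` `[(0 : R), +oo[].
Proof. by rewrite inE /= in_itv /= lexx. Qed.

Definition half_line0 : half_line := exist _ (0 : R) zero_in_half_line.

Definition cpath : Type := continuousType half_line R.

HB.instance Definition _ := Choice.on cpath.

Definition cpath0 : cpath := @mkcts half_line R (fun=> 0) (@cst_continuous _ _ 0).

HB.instance Definition _ := isPointed.Build cpath cpath0.

(* Generated by the coordinates; on this space it coincides with the Borel
   sigma-algebra of locally uniform convergence. *)
Definition cylinders : set (set cpath) :=
  \bigcup_(t : half_line)
    preimage_set_system [set: cpath] (fun w : cpath => w t) measurable.

Definition path_space := g_sigma_algebraType cylinders.

(* Times are taken in [R]; for [t < 0] this is the junk value [w 0]. *)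
Definition brownian (w : path_space) (t : R) : R := (w : cpath) (insubd half_line0 t).

Definition wiener_measure (P : probability path_space R) : Prop :=
  P [set w | brownian w 0 = 0] = 1%E /\
  forall (n : nat) (t : nat -> R) (A : nat -> set R),
    0 <= t 0%N -> (forall i, (i < n)%N -> t i < t i.+1) ->
    (forall i, (i < n)%N -> measurable (A i)) ->
    P [set w | forall i, (i < n)%N -> A i (brownian w (t i.+1) - brownian w (t i))] =
    (\prod_(i < n) normal_prob 0 (Num.sqrt (t i.+1 - t i)) (A i))%E.

Definition occupation (w : path_space) (t : R) (A : set R) : \bar R :=
  (\int[lebesgue_measure]_(s in `[0%R, t]) (\1_A (brownian w s))%:E)%E.

(* [l w x t] is the local time at level [x] and time [t]; as for any version
   of a random field, the defining properties hold almost surely. *)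
Definition local_time (P : probability path_space R)
    (l : path_space -> R -> R -> R) : Prop :=
  (forall x t, 0 <= t -> measurable_fun [set: path_space] (fun w => l w x t)) /\
  {ae P, forall w,
    {within [set: R] `*` `[0, +oo[, continuous (fun xt => l w xt.1 xt.2)} /\
    forall t (A : set R), 0 <= t -> measurable A ->
      occupation w t A = (\int[lebesgue_measure]_(x in A) (l w x t)%:E)%E}.

Section embedded_walk.
Variables (k : nat) (w : path_space).

Definition mesh : R := 2 ^- k.

Fixpoint hit (n : nat) : \bar R :=
  if n is n'.+1 then
    ereal_inf [set t%:E | t in [set t : R |
      (hit n' < t%:E)%E /\ `|brownian w t - brownian w (fine (hit n'))| = mesh]]
  else 0%E.

(* Meaningful for [1 <= n]. *)
Definition eta (n : nat) : R :=
  if (hit n < +oo)%E then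
    let d := brownian w (fine (hit n)) - brownian w (fine (hit n.-1)) in
    if d == mesh then 1 else if d == - mesh then -1 else 0
  else 0.

Definition walk (t : R) : R :=
  limn (fun N => \sum_(1 <= n < N) mesh * eta n * \1_[set s | (hit n <= s%:E)%E] t).

(* The maximum of [{n | hit n <= t}], which exists for [0 <= t] since a
   continuous path has finitely many such [n]. *)
Definition nsteps (t : R) : nat :=
  xget 0%N [set n | (hit n <= t%:E)%E /\
                    forall p, (hit p <= t%:E)%E -> (p <= n)%N].

(* Upcrossings from [(j - 1) * mesh] to [j * mesh] up to time [t]. *)
Definition upcrossings (j : int) (t : R) : nat :=
  #|[pred n : 'I_(nsteps t) |
      (walk (fine (hit n)) == (j - 1)%:~R * mesh) &&
      (walk (fine (hit n.+1)) == j%:~R * mesh)]|.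

Definition level (x : R) : int := Num.ceil (x / mesh).

Definition norm_upcrossings (t x : R) : R := 2 * mesh * (upcrossings (level x) t)%:R.

Lemma level_itv (x : R) :
  ((level x - 1)%:~R * mesh < x <= (level x)%:~R * mesh)%R.
Proof.
have m0 : 0 < mesh by rewrite /mesh invr_gt0 exprn_gt0.
by rewrite -ltr_pdivlMr // -ler_pdivrMr // /level ceil_itv.
Qed.

End embedded_walk.

(* The [q]-th power of the [q]-variation norm over [[a, b]]; it is
   [total_variation] when [q = 1]. *)
Definition q_variation (q a b : R) (f : R -> R) : \bar R :=
  ereal_sup [set (let F := f \o nth b (a :: s) in
                  \sum_(0 <= n < size s) `|F n.+1 - F n| `^ q)%:E
            | s in itv_partition a b].

Definition q_variation_I (q : R) (m : nat) (f : R -> R) : \bar R :=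
  q_variation q (- 2 ^+ m) (2 ^+ m) f.

End path_space.

(* Main.v *)
From HB Require Import structures.
Require Import Defs.
From mathcomp Require Import all_boot all_order all_algebra.
From mathcomp Require Import all_classical all_reals all_analysis.
From mathcomp Require Import measurable_realfun.
From mathcomp Require Import zify ring lra.

(** The first term on the right-hand side is nonnegative, so it suffices to bound
    the expectations on the left by [C * T `^ (q / 4)], where [q = 2 + delta] and
    [q / 4 = 1 / 2 + delta / 4].  The function [x |-> U^k(t, x)] is constant
    between lattice points, and its increments between levels at distance [lam]
    turn out to have size [sqrt lam * T ^ (1 / 4)], as those of Brownian local time.

    Increments.  Tanaka's formula for a nearest neighbour walk
    ([discrete_tanaka_diff]) writes the difference of the upcrossing numbers at two
    levels as a boundary term plus the sum of the steps of the walk made while its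
    position is between the levels.  The boundary term is at most the square root
    of [lam * |X|].  The sum is the stochastic integral of the indicator that the
    last lattice point visited by the Brownian path is between the levels.  This
    indicator is adapted ([measurable_last_below]), and the integral up to any
    time is a limit, path by path, of discrete integrals over dyadic grids of
    [0, T] ([cvg_transform_hit]); these are dominated by running maxima over the
    grid, and this takes care of the supremum over [t].

    Moments.  A discrete integral has an exponential martingale
    ([exp_transform]) whose clock is at most the time that the path spends in a
    strip of width [lam + mesh].  Conditionally on the past, the expected time still
    to be spent in the strip is of order [lam * sqrt T] since Gaussian
    densities are bounded, hence the clock has exponential moments at this scale
    ([exp_clock_le2], Khasminskii's lemma).  Stopping the integral when it first
    reaches a given height yields an exponential tail for its running maximum and
    so the moment bound [strip_moment].  Together, the increments have
    [q]-th moment of order [lam ^ (q / 2) * T ^ (q / 4)] ([increment_moment]).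

    Chaining.  Every increment is a sum over dyadic blocks of levels, at most two
    of each size, so the [q]-variation is bounded by a weighted sum of the [q]-th
    powers of the increments over all dyadic blocks ([chain_variation_le]).  At
    scale [2 ^ (-j)] there are [2 ^ j] blocks whose [q]-th powers have expectation
    of order [2 ^ (- j * q / 2)], and [q / 2 > 1]; weights [2 ^ (j * delta / 4)] are large
    enough for the chaining and small enough for the expectation
    ([dyadic_weights]).  All sums are geometric, so the bound is
    uniform in the scale of the walk.  Fatou's lemma removes the time grid. *)

Import Order.TTheory GRing.Theory Num.Theory.
Import numFieldNormedType.Exports.

Set SsrOldRewriteGoalsOrder.
Set Implicit Arguments.
Unset Strict Implicit.
Unset Printing Implicit Defensive.

Local Open Scope classical_set_scope.
Local Open Scope ring_scope.

(** * Gaussian estimates *)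

(** [normal_prob] is introduced through its values on sets; the change of
variables along the Radon-Nikodym derivative turns it into a density, so that
Gaussian integrals can be computed. *)
Lemma integral_normal_prob (R : realType) (s : R) (f : measurableTypeR R -> \bar R) :
  measurable_fun setT f -> (forall x, 0 <= f x)%E ->
  (\int[normal_prob 0 s]_x f x =
   \int[lebesgue_measure]_x (f x * (normal_pdf 0 s x)%:E))%E.
Proof.
move=> mf f0.
have dom := normal_prob_dominates (0 : R) s.
rewrite -(Radon_Nikodym_SigmaFinite.change_of_variables dom)//=.
apply: ae_eq_integral => //=.
- apply: emeasurable_funM => //; apply: (measurable_int lebesgue_measure).
  exact: Radon_Nikodym_SigmaFinite.f_integrable.
- apply: emeasurable_funM => //.
  by apply/measurable_EFinP; exact: measurable_normal_pdf.
- apply: ae_eqe_mul2l.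
  apply: integral_ae_eq => //=.
  + exact: Radon_Nikodym_SigmaFinite.f_integrable.
  + by apply/measurable_EFinP; exact: measurable_normal_pdf.
  + move=> E _ mE; rewrite -Radon_Nikodym_SigmaFinite.f_integral//=.
Qed.

(** Completing the square: tilting the centred density by [expR (c * x)] moves
its mean to [c * s ^+ 2], up to a constant factor. *)
Lemma normal_mgf (R : realType) (s c : R) : s != 0 ->
  (\int[normal_prob 0%R s]_x (expR (c * x))%:E = (expR (c ^+ 2 * s ^+ 2 / 2))%:E)%E.
Proof.
move=> s0.
rewrite integral_normal_prob//=; last first.
  apply/measurable_EFinP; apply: measurableT_comp => //.
transitivity (\int[lebesgue_measure]_x
   ((expR (c ^+ 2 * s ^+ 2 / 2))%:E * (normal_pdf (c * s ^+ 2) s x)%:E))%E.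
  apply: eq_integral => x _; rewrite -!EFinM; congr EFin.
  rewrite !normal_pdfE// mulrCA [RHS]mulrCA; congr (_ * _).
  rewrite /normal_fun -!expRD; congr expR.
  by field.
rewrite ge0_integralZl//=.
- by rewrite integral_normal_pdf mule1.
- by apply/measurable_EFinP; exact: measurable_normal_pdf.
- by move=> x _; rewrite lee_fin normal_pdf_ge0.
Qed.

(** The Gaussian density never exceeds [(s * sqrt (2 * pi))^-1 <= s^-1].  This is
the only quantitative input about how long the path can stay in a strip. *)
Lemma normal_prob_itv_le (R : realType) (s a b : R) : 0 < s -> a <= b ->
  (normal_prob 0%R s `[a, b]%classic <= ((b - a) / s)%:E)%E.
Proof.
move=> s0 ab; rewrite /normal_prob.
apply: (@le_trans _ _ (\int[lebesgue_measure]_(x in `[a, b]%classic) (s^-1)%:E)%E).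
  apply: ge0_le_integral => //=.
  - by move=> x _; rewrite lee_fin normal_pdf_ge0.
  - by apply/measurable_EFinP/measurable_funTS; exact: measurable_normal_pdf.
  - move=> x _; rewrite lee_fin (le_trans (normal_pdf_ub _ _ _)) ?gt_eqF//.
    rewrite /normal_peak lef_pV2 ?posrE//; last first.
      by rewrite sqrtr_gt0 mulrn_wgt0// mulr_gt0 ?pi_gt0 ?exprn_gt0.
    rewrite -[leLHS](ger0_norm (ltW s0)) -sqrtr_sqr; apply: ler_wsqrtr.
    rewrite -mulrnAr ler_peMr ?sqr_ge0//.
    by have := @pi_ge2 R; lra.
rewrite integral_cst//= lebesgue_measure_itv/= lte_fin.
case: ltP => [ab'|ba]; first by rewrite -EFinD -EFinM mulrC.
by rewrite mule0 lee_fin divr_ge0 ?subr_ge0 // ltW.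
Qed.

(** * Wiener increments *)

(** Dynkin's argument: the events satisfying the product rule with a fixed [F]
form a Dynkin system. *)
Lemma independent_g_sigma d (Om : measurableType d) (R : realType)
    (P : probability Om R) (G : set (set Om)) (F : set Om) :
  setI_closed G -> G `<=` measurable -> measurable F ->
  (forall E, G E -> P (E `&` F) = P E * P F)%E ->
  forall E, <<s G >> E -> (P (E `&` F) = P E * P F)%E.
Proof.
move=> GI Gm mF GF.
have mG : <<s G >> `<=` measurable.
  by apply: smallest_sub => //; exact: sigma_algebra_measurable.
apply: (@dynkin_induction _ (g_sigma_algebraType G) G
  (fun E : set Om => P (E `&` F) = P E * P F)%E) => //.
- by rewrite setTI probability_setT mul1e.
- move=> E mE EF; have {}mE : @measurable _ Om E by exact: mG.
  rewrite setIC -setDE measureD//=; last by rewrite -ge0_fin_numE// fin_num_measure.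
  rewrite setIC EF probability_setC// muleBl ?mul1e//.
    by rewrite fin_num_measure.
- move=> S mS tS SF.
  have {}mS n : @measurable _ Om (S n) by apply: mG; exact: mS.
  rewrite setI_bigcupl !measure_bigcup//=.
  + under eq_eseriesr do rewrite SF muleC.
    rewrite muleC -[P F]fineK ?fin_num_measure//.
    by rewrite nneseriesZl.
  + by move=> n _; exact: measurableI.
  + by apply: trivIset_setIr.
Qed.

Section wiener_increments.
Variables (R : realType) (P : probability (path_space R) R).
Hypothesis wP : wiener_measure P.
Local Notation W := (path_space R).

Lemma measurable_brownian (t : R) : measurable_fun setT (fun w : W => brownian w t).
Proof.
move=> _ A mA; rewrite setTI.
apply: sub_sigma_algebra; exists (insubd (half_line0 R) t) => //.
by exists A => //; rewrite setTI.
Qed.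

(** For a Wiener measure this is almost surely the path itself; subtracting the
initial value makes it a sum of increments for every path, so that it can be
handled without discarding null sets. *)
Definition displacement (w : W) (t : R) : R := brownian w t - brownian w 0.

Lemma measurable_displacement (t : R) :
  measurable_fun setT (fun w : W => displacement w t).
Proof. by apply: measurable_funB; exact: measurable_brownian. Qed.

(** The events for which a Wiener measure gives a product formula directly; they
form a pi-system. *)
Definition increment_boxes (t : nat -> R) (n : nat) : set (set W) :=
  [set [set w | forall i, (i < n)%N -> A i (brownian w (t i.+1) - brownian w (t i))]
  | A in [set A : nat -> set R | forall i, measurable (A i)]].

Lemma increment_boxesI t n : setI_closed (increment_boxes t n).
Proof.
move=> _ _ [A mA <-] [B mB <-]; exists (fun i => A i `&` B i).
  by move=> i; exact: measurableI.
rewrite predeqE => w; split => [h|[h1 h2] i ni]; last by split; [exact: h1|exact: h2].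
by split=> i ni; have [] := h _ ni.
Qed.

Lemma measurable_increment_boxes t n : increment_boxes t n `<=` measurable.
Proof.
move=> _ [A mA <-].
rewrite [X in measurable X](_ : _ = \bigcap_i [set w : W | (i < n)%N ->
   A i (brownian w (t i.+1) - brownian w (t i))]); last first.
  by rewrite predeqE => w; split => [h i _|h i]; [exact: h|exact: (h i)].
apply: bigcapT_measurable => i; have [ni|ni] := ltnP i n; last first.
  rewrite [X in measurable X](_ : _ = setT)//; rewrite predeqE => w; split => //=.
rewrite [X in measurable X](_ : _ =
   (fun w : W => brownian w (t i.+1) - brownian w (t i)) @^-1` A i); last first.
  by rewrite predeqE => w; split => [h|h _] //; exact: h.
rewrite -[X in measurable X]setTI.
by apply: measurable_funB (mA i) => //; exact: measurable_brownian.
Qed.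

Lemma increment_law (s s' : R) (A : set R) : 0 <= s -> s < s' -> measurable A ->
  (P [set w | A (brownian w s' - brownian w s)%R] = normal_prob 0%R (Num.sqrt (s' - s)%R) A)%E.
Proof.
move=> s0 ss' mA; case: wP => _ /(_ 1%N (fun i => if i is 0%N then s else s') (fun=> A) s0).
rewrite big_ord_recl big_ord0 mule1 /= => <- //.
  by congr (P _); rewrite predeqE => w; split => [h []//|/(_ 0%N)]; exact.
by case.
Qed.

(** Appending the condition on the last increment to a box gives a box with one
more side, so the product rule holds on boxes and extends by Dynkin's argument. *)
Lemma increments_independent (t : nat -> R) n s' (E : set W) (A : set R) :
  0 <= t 0%N -> (forall i, (i < n)%N -> t i < t i.+1) -> t n < s' ->
  <<s increment_boxes t n >> E -> measurable A ->
  (P (E `&` [set w | A (brownian w s' - brownian w (t n))%R]) =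
   P E * normal_prob 0%R (Num.sqrt (s' - t n)%R) A)%E.
Proof.
move=> t0 tS tn EG mA.
have tn0 : 0 <= t n.
  have : forall m, (m <= n)%N -> 0 <= t m.
    by elim=> // m IH mn; apply: le_trans (ltW (tS m mn)); apply: IH; exact: ltnW.
  exact.
rewrite -increment_law//.
apply: (independent_g_sigma (@increment_boxesI t n)) EG.
- exact: measurable_increment_boxes.
- rewrite -[X in measurable X]setTI.
  by apply: measurable_funB mA => //; exact: measurable_brownian.
move=> _ [B mB <-].
pose t' i := if (i <= n)%N then t i else s'.
pose B' i := if (i < n)%N then B i else A.
case: wP => _ wP'.
have t'0 : t' 0%N = t 0%N by [].
have -> : [set w : W | forall i, (i < n)%N -> B i (brownian w (t i.+1) - brownian w (t i))]
  `&` [set w | A (brownian w s' - brownian w (t n))] =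
  [set w | forall i, (i < n.+1)%N -> B' i (brownian w (t' i.+1) - brownian w (t' i))].
  rewrite predeqE => w; split => [[h1 h2] i|h].
    rewrite ltnS leq_eqVlt /B' /t' => /orP[/eqP ->|ni].
      by rewrite ltnn leqnn.
    by rewrite ni (ltnW ni); exact: h1.
  split => [i ni|].
    by have := h i (ltnW ni); rewrite /B' /t' ni (ltnW ni).
  by have := h n (ltnSn n); rewrite /B' /t' leqnn ltnn.
have t'S i : (i < n.+1)%N -> t' i < t' i.+1.
  rewrite ltnS leq_eqVlt /t' => /orP[/eqP ->|ni]; first by rewrite ltnn leqnn.
  by rewrite ni (ltnW ni); exact: tS.
have mB' i : (i < n.+1)%N -> measurable (B' i) by move=> _; rewrite /B'; case: ifP.
etransitivity; first exact: (wP' n.+1 t' B' t0 t'S mB').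
have -> : P [set w : W | forall i, (i < n)%N -> B i (brownian w (t i.+1) - brownian w (t i))] =
  (\prod_(i < n) normal_prob 0%R (Num.sqrt (t i.+1 - t i)%R) (B i))%E.
  exact: (wP' n t B t0 tS (fun i _ => mB i)).
rewrite (increment_law tn0 tn mA).
rewrite big_ord_recr/=.
have -> : B' n = A by rewrite /B' ltnn.
have -> : t' n.+1 = s' by rewrite /t' ltnn.
have -> : t' n = t n by rewrite /t' leqnn.
apply: (f_equal (fun z => z * normal_prob 0%R (Num.sqrt (s' - t n)%R) A)%E).
by apply: eq_bigr => i _; rewrite /B' /t' ltn_ord (ltnW (ltn_ord i)).
Qed.

End wiener_increments.

(** * The dyadic past *)

Section dyadic_past.
Variables (R : realType) (T : R).
Local Notation W := (path_space R).

Definition grid (N r : nat) : R := r%:R * T / 2 ^+ N.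

(** Only the dyadic fractions of [T] before [s] are observed.  They determine a
continuous path up to time [s], and for [s] on a dyadic grid the independence of
the future reduces to finitely many times. *)
Definition past_events (s : R) : set (set W) :=
  \bigcup_(p in [set p : nat * nat | grid p.1 p.2 <= s])
    preimage_set_system setT (fun w : W => displacement w (grid p.1 p.2)) measurable.

Definition past (s : R) := g_sigma_algebraType (past_events s).

Lemma grid_refine N M r : (N <= M)%N -> grid N r = grid M (r * 2 ^ (M - N)).
Proof.
move=> NM; rewrite /grid natrM natrX -{2}(subnK NM) exprD invfM.
set a := 2 ^+ (M - N); have a0 : a != 0 by rewrite expf_neq0.
by rewrite mulrA; congr (_ / _); rewrite mulrAC mulfK.
Qed.

Lemma measurable_displacement_past s N r : grid N r <= s ->
  measurable_fun setT (fun w : past s => displacement w (grid N r)).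
Proof.
move=> rs _ A mA; rewrite setTI.
apply: sub_sigma_algebra; exists (N, r) => //.
by exists A => //; rewrite setTI.
Qed.

Lemma past_le s s' : s <= s' -> <<s past_events s >> `<=` <<s past_events s' >>.
Proof.
move=> ss'; apply: sub_sigma_algebra2 => A [p ps Ap]; exists p => //.
exact: le_trans ps ss'.
Qed.

Lemma measurable_past s (A : set W) : @measurable _ (past s) A -> measurable A.
Proof.
apply: smallest_sub; first exact: sigma_algebra_measurable.
move=> _ [p _ [B mB <-]]; rewrite setTI -[X in measurable X]setTI.
exact: measurable_displacement.
Qed.

Hypothesis T0 : 0 < T.

Lemma grid_lt N : {mono grid N : i j / (i < j)%N >-> i < j}.
Proof.
by move=> i j; rewrite /grid ltr_pM2r ?invr_gt0 ?exprn_gt0// ltr_pM2r// ltr_nat.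
Qed.

Lemma grid_le N : {mono grid N : i j / (i <= j)%N >-> i <= j}.
Proof.
by move=> i j; rewrite /grid ler_pM2r ?invr_gt0 ?exprn_gt0// ler_pM2r// ler_nat.
Qed.

Lemma grid0 N : grid N 0 = 0. Proof. by rewrite /grid mul0r mul0r. Qed.

Lemma grid_ge0 N r : 0 <= grid N r.
Proof. by rewrite -(grid0 N) grid_le. Qed.

Lemma gridT N : grid N (2 ^ N) = T.
Proof. by rewrite /grid natrX; field; rewrite expf_neq0. Qed.

Lemma measurable_displacement_boxes M n i : (i <= n)%N ->
  measurable_fun setT
    (fun w : g_sigma_algebraType (increment_boxes (grid M) n) => displacement w (grid M i)).
Proof.
elim: i => [_|i IH lin].
  rewrite [X in measurable_fun _ X](_ : _ = cst 0); first exact: measurable_cst.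
  by apply/funext => w; rewrite /displacement grid0 /= subrr.
rewrite [X in measurable_fun _ X](_ : _ =
  ((fun w : W => displacement w (grid M i)) \+
   (fun w : W => brownian w (grid M i.+1) - brownian w (grid M i)))); last first.
  by apply/funext => w; rewrite /displacement /=; ring.
apply: measurable_funD; first by apply: IH; exact: ltnW.
move=> _ A mA; rewrite setTI; apply: sub_sigma_algebra.
exists (fun j => if j == i then A else setT).
  by move=> j; case: ifP.
rewrite predeqE => w; split => [/(_ i lin)|]; first by rewrite eqxx.
by move=> h j jn; case: eqVneq => // ->.
Qed.

Lemma measurable_displacement_refined M M' n i : (M <= M')%N -> (i <= n)%N ->
  measurable_fun setT
    (fun w : g_sigma_algebraType (increment_boxes (grid M') (n * 2 ^ (M' - M))) =>
       displacement w (grid M i)).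
Proof.
move=> MM' lin; rewrite (grid_refine _ MM').
by apply: measurable_displacement_boxes; rewrite leq_mul2r lin orbT.
Qed.

(** A coarse increment is the sum of the finer increments that it contains. *)
Lemma increment_boxes_refine M M' n : (M <= M')%N ->
  <<s increment_boxes (grid M) n >> `<=`
  <<s increment_boxes (grid M') (n * 2 ^ (M' - M)) >>.
Proof.
move=> MM'; apply: smallest_sub; first exact: smallest_sigma_algebra.
move=> _ [A mA <-].
set Om := g_sigma_algebraType (increment_boxes (grid M') (n * 2 ^ (M' - M))).
change (@measurable _ Om [set w : W | forall i, (i < n)%N ->
   A i (brownian w (grid M i.+1) - brownian w (grid M i))]).
rewrite [X in measurable X](_ : _ = \bigcap_i [set w : W | (i < n)%N ->
   A i (brownian w (grid M i.+1) - brownian w (grid M i))]); last first.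
  by rewrite predeqE => w; split => [h i _|h i]; [exact: h|exact: (h i)].
apply: bigcapT_measurable => i; have [ni|ni] := ltnP i n; last first.
  rewrite [X in measurable X](_ : _ = setT)//; rewrite predeqE => w; split => //=.
rewrite [X in measurable X](_ : _ =
   (fun w : Om => displacement w (grid M i.+1) - displacement w (grid M i)) @^-1` A i); last first.
  rewrite predeqE => w; rewrite /= /displacement.
  have -> : brownian w (grid M i.+1) - brownian w 0 -
     (brownian w (grid M i) - brownian w 0) =
     brownian w (grid M i.+1) - brownian w (grid M i) by ring.
  by split => [h|h _] //; exact: h.
rewrite -[X in measurable X]setTI.
apply: measurable_funB (mA i) => //.
- exact: measurable_displacement_refined.
- by apply: measurable_displacement_refined => //; exact: ltnW.
Qed.

Variable P : probability W R.
Hypothesis wP : wiener_measure P.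

(** The past at [s] is generated by the union over [M] of the increments up to [s]
on the grids refined [M] times.  The union is increasing, hence a pi-system, and
on each of its members independence is that of finitely many increments. *)
Lemma past_independent N r s' (E : set W) (A : set R) :
  grid N r < s' -> @measurable _ (past (grid N r)) E -> measurable A ->
  (P (E `&` [set w | A (displacement w s' - displacement w (grid N r))%R]) =
   P E * normal_prob 0%R (Num.sqrt (s' - grid N r)%R) A)%E.
Proof.
move=> rs' mE mA.
pose G := \bigcup_M <<s increment_boxes (grid (N + M)) (r * 2 ^ M) >>.
have incE (s : R) : [set w : W | A (displacement w s' - displacement w s)] =
    [set w | A (brownian w s' - brownian w s)].
  rewrite predeqE => w; rewrite /displacement /=.
  by have -> : brownian w s' - brownian w 0 - (brownian w s - brownian w 0) =
    brownian w s' - brownian w s by ring.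
have G_nested M M' : (M <= M')%N ->
    <<s increment_boxes (grid (N + M)) (r * 2 ^ M) >> `<=`
    <<s increment_boxes (grid (N + M')) (r * 2 ^ M') >>.
  move=> MM'; have := @increment_boxes_refine (N + M) (N + M') (r * 2 ^ M).
  by rewrite leq_add2l subnDl -mulnA -expnD subnKC//; exact.
have GI : setI_closed G.
  move=> B C [M1 _ B1] [M2 _ C2]; exists (maxn M1 M2) => //.
  set Om := g_sigma_algebraType
    (increment_boxes (grid (N + maxn M1 M2)) (r * 2 ^ maxn M1 M2)).
  apply: (@measurableI _ Om).
  - by apply: G_nested B1; exact: leq_maxl.
  - by apply: G_nested C2; exact: leq_maxr.
have Gm : G `<=` measurable.
  move=> B [M _]; apply: smallest_sub; first exact: sigma_algebra_measurable.
  exact: measurable_increment_boxes.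
have pastG : past_events (grid N r) `<=` G.
  move=> _ [[M i] /= ir [B mB <-]]; rewrite setTI.
  exists M => //.
  have lNM : (M <= N + M)%N by exact: leq_addl.
  rewrite (grid_refine i lNM).
  set n := (i * _)%N.
  rewrite -[X in <<s _ >> X]setTI.
  apply: (measurable_displacement_boxes _) mB => //.
  rewrite -(grid_le (N + M)) /n -(grid_refine i lNM).
  by rewrite (le_trans ir)// (grid_refine r (leq_addr M N)) addKn.
have mAs : measurable [set w : W | A (displacement w s' - displacement w (grid N r))].
  rewrite -[X in measurable X]setTI.
  by apply: measurable_funB mA => //; exact: measurable_displacement.
have PA : P [set w : W | A (displacement w s' - displacement w (grid N r))] =
    normal_prob 0%R (Num.sqrt (s' - grid N r)) A.
  by rewrite incE increment_law// grid_ge0.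
rewrite -PA.
apply: (independent_g_sigma GI) => //; last first.
  by move: mE; apply: sub_sigma_algebra2.
move=> {mE}E [M _ EM]; rewrite PA incE.
have rM : grid (N + M) (r * 2 ^ M) = grid N r.
  by rewrite (grid_refine r (leq_addr M N)) addKn.
rewrite -rM; apply: (increments_independent wP) EM mA.
- by rewrite grid_ge0.
- by move=> i _; rewrite grid_lt.
- by rewrite rM.
Qed.

End dyadic_past.

(** * Conditioning on the past *)

Section conditioning.
Variables (R : realType) (T : R) (T0 : 0 < T).
Variables (P : probability (path_space R) R) (wP : wiener_measure P).
Local Notation W := (path_space R).
Local Notation grid := (grid T).
Local Notation past := (past T).

Lemma measurable_fun_past d (Y : measurableType d) (s : R) (f : W -> Y) :
  measurable_fun setT (f : past s -> Y) -> measurable_fun setT f.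
Proof.
move=> mf _ A mA; rewrite setTI; apply: (@measurable_past _ T s).
by rewrite -[X in measurable X]setTI; exact: mf.
Qed.

(** Knowledge increases with time, which is what makes an adapted sum adapted. *)
Lemma measurable_fun_past_le d (Y : measurableType d) (s s' : R) (f : W -> Y) :
  s <= s' -> measurable_fun setT (f : past s -> Y) ->
  measurable_fun setT (f : past s' -> Y).
Proof.
move=> ss' mf _ A mA; rewrite setTI; apply: (past_le ss').
by rewrite -[X in <<s _ >> X]setTI; exact: mf.
Qed.

(** Conditioning on the past: the joint law of the past and of the next increment
is a product, so the increment may be integrated first with the past frozen. *)
Lemma past_fubini N r s' (g : past (grid N r) * measurableTypeR R -> \bar R) :
  grid N r < s' -> measurable_fun setT g -> (forall z, 0 <= g z)%E ->
  (\int[P]_w g (w, (displacement w s' - displacement w (grid N r))%R) =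
   \int[P]_w \int[normal_prob 0%R (Num.sqrt (s' - grid N r)%R)]_x g (w, x))%E.
Proof.
move=> rs' mg g0; set s := grid N r.
pose id_past : W -> past s := id.
have mid : measurable_fun setT id_past.
  by move=> _ A mA; rewrite setTI; exact: measurable_past mA.
pose jnt : W -> past s * measurableTypeR R :=
  fun w => (w, displacement w s' - displacement w s).
have mjnt : measurable_fun setT jnt.
  apply/measurable_fun_pairP; split => //.
  by apply: measurable_funB; exact: measurable_displacement.
pose idX : {mfun W >-> past s} := HB.pack id_past (isMeasurableFun.Build _ _ _ _ _ mid).
pose jX : {mfun W >-> (past s * measurableTypeR R)%type} :=
  HB.pack jnt (isMeasurableFun.Build _ _ _ _ _ mjnt).
pose nu : probability (measurableTypeR R) R := normal_prob 0%R (Num.sqrt (s' - s)%R).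
have uniq (X : set (past s * measurableTypeR R)) : measurable X ->
    (distribution P idX \x nu)%E X = distribution P jX X.
  apply: product_measure_unique => A B mA mB.
  exact: past_independent.
transitivity (\int[distribution P jX]_z g z)%E.
  by rewrite ge0_integral_pushforward.
transitivity (\int[(distribution P idX \x nu)%E]_z g z)%E.
  by apply: eq_measure_integral => A mA _; apply: esym; exact: uniq.
rewrite fubini_tonelli1// ge0_integral_pushforward//.
  exact: measurable_fun_fubini_tonelli_F.
by move=> w _; apply: integral_ge0.
Qed.

Lemma past_exp_increment N r s' (f : W -> \bar R) (c : R) :
  grid N r < s' -> measurable_fun setT (f : past (grid N r) -> \bar R) ->
  (forall w, 0 <= f w)%E ->
  (\int[P]_w (f w * (expR (c * (displacement w s' - displacement w (grid N r)))%R)%:E) =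
   \int[P]_w f w * (expR (c ^+ 2 * (s' - grid N r) / 2))%:E)%E.
Proof.
move=> rs' mf f0.
pose g (z : past (grid N r) * measurableTypeR R) : \bar R :=
  (f z.1 * (expR (c * z.2))%:E)%E.
have mg : measurable_fun setT g.
  apply: emeasurable_funM; first exact: measurableT_comp.
  apply/measurable_EFinP; apply: measurableT_comp => //.
  by apply: measurable_funM => //; exact: measurable_cst.
have g0 z : (0 <= g z)%E by rewrite mule_ge0// lee_fin expR_ge0.
rewrite (past_fubini rs' mg g0) -ge0_integralZr//=.
- apply: eq_integral => w _; rewrite /g /= ge0_integralZl//=.
  + rewrite normal_mgf; first by rewrite sqr_sqrtr// subr_ge0 ltW.
    by rewrite gt_eqF// sqrtr_gt0 subr_gt0.
  + apply/measurable_EFinP; apply: measurableT_comp => //.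
- exact: measurable_fun_past mf.
Qed.

(** Given the past at an earlier time, the position is Gaussian with standard
deviation the square root of the elapsed time. *)
Lemma past_itv_le N r s' (f : W -> \bar R) (a b : R) : a <= b ->
  grid N r < s' -> measurable_fun setT (f : past (grid N r) -> \bar R) ->
  (forall w, 0 <= f w)%E ->
  (\int[P]_w (f w * (\1_(`[a, b]%classic) (displacement w s'))%:E) <=
   \int[P]_w f w * ((b - a) / Num.sqrt (s' - grid N r))%:E)%E.
Proof.
move=> ab rs' mf f0; set s := grid N r.
have mX := measurable_displacement_past (lexx s).
pose g (z : past s * measurableTypeR R) : \bar R :=
  (f z.1 * (\1_(`[a, b]%classic) (displacement z.1 s + z.2))%:E)%E.
have mg : measurable_fun setT g.
  apply: emeasurable_funM; first exact: measurableT_comp.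
  apply/measurable_EFinP; apply: measurableT_comp => //.
  apply: measurable_funD => //.
  by apply: (measurableT_comp mX).
have g0 z : (0 <= g z)%E by rewrite mule_ge0// lee_fin.
have sd0 : 0 < Num.sqrt (s' - s) by rewrite sqrtr_gt0 subr_gt0.
rewrite [leLHS](_ : _ = \int[P]_w g (w, (displacement w s' - displacement w s)%R))%E; last first.
  by apply: eq_integral => w _; rewrite /g /= addrC subrK.
rewrite (past_fubini rs' mg g0) -ge0_integralZr//=; last 2 first.
- exact: measurable_fun_past mf.
- by rewrite lee_fin divr_ge0 ?subr_ge0// ltW.
apply: ge0_le_integral => //=.
- by move=> w _; apply: integral_ge0.
- apply: (@measurable_fun_past _ _ s
    (fubini_F (normal_prob 0%R (Num.sqrt (s' - s)%R) : probability _ R) g)).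
  exact: measurable_fun_fubini_tonelli_F.
- by apply: emeasurable_funM => //; exact: measurable_fun_past mf.
move=> w _; rewrite /g /= ge0_integralZl//=; last first.
  apply/measurable_EFinP; apply: measurableT_comp => //.
  by apply: measurable_funD => //; exact: measurable_cst.
apply: lee_wpmul2l => //.
rewrite (_ : (fun x => _) = (fun x => (\1_(`[a - displacement w s, b - displacement w s]%classic) x)%:E)); last first.
  apply/funext => x; rewrite !indicE; congr ((nat_of_bool _)%:R%:E).
  by apply/idP/idP; rewrite !inE /= !in_itv /=; lra.
rewrite integral_indic//= setIT.
apply: le_trans (normal_prob_itv_le sd0 _) _; first by lra.
by rewrite lee_fin (_ : b - _ - _ = b - a)//; ring.
Qed.

End conditioning.

(** * Events about the last visit *)

Section last_visit.
Variables (R : realType) (T : R).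
Local Notation W := (path_space R).

(** For a continuous path: some [u <= s] has [X u <= a], and [X] stays below [b] on
[u, s].  The two slacks allow the quantifiers to range over dyadic times, hence
over countable sets, so that the event belongs to the past at [s].  With
[a = c * mesh] and [b = (c + 1) * mesh], and for a path that starts at 0, it says
that the last lattice point visited by the time [s] is at most [c * mesh],
without mentioning the hitting times. *)
Definition last_below (a b s : R) : set W := [set w | exists p, forall e, exists M i,
  [/\ grid T M i <= s, displacement w (grid T M i) <= a + e.+1%:R^-1 &
      forall M' j, grid T M i <= grid T M' j <= s ->
        displacement w (grid T M' j) <= b - p.+1%:R^-1]].

Lemma measurable_last_below a b s : @measurable _ (past T s) (last_below a b s).
Proof.
set Om := past T s.
rewrite [X in measurable X](_ : _ = \bigcup_p \bigcap_e \bigcup_M \bigcup_i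
  ((if grid T M i <= s then (fun w : Om => displacement w (grid T M i)) @^-1` `]-oo, a + e.+1%:R^-1]%classic
   else set0) `&`
  \bigcap_M' \bigcap_j (if grid T M i <= grid T M' j <= s then
     (fun w : Om => displacement w (grid T M' j)) @^-1` `]-oo, b - p.+1%:R^-1]%classic else setT))).
  apply: bigcupT_measurable => p; apply: bigcapT_measurable => e.
  apply: bigcupT_measurable => M; apply: bigcupT_measurable => i.
  apply: measurableI.
    case: ifPn => // Mis; rewrite -[X in measurable X]setTI.
    exact: measurable_displacement_past.
  apply: bigcapT_measurable => M'; apply: bigcapT_measurable => j.
  case: ifPn => // /andP[_ Mjs]; rewrite -[X in measurable X]setTI.
  exact: measurable_displacement_past.
rewrite predeqE => w; split=> [[p h]|[p _ h]].
- exists p => // e _; have [M [i [Mis wMi h']]] := h e.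
  exists M => //; exists i => //; split; first by rewrite Mis /= in_itv.
  by move=> M' _ j _; case: ifPn => // /h'; rewrite /= in_itv.
- exists p => e; have [M _ [i _ [h1 h2]]] := h e I.
  exists M, i; move: h1; case: ifPn => // Mis; rewrite /= in_itv /= => wMi.
  split => // M' j MM'; have := h2 M' I j I.
  by rewrite MM' /= in_itv.
Qed.

End last_visit.

(** * Exponential martingales of adapted transforms *)

Lemma indic_le1 (R : realType) (X : Type) (A : set X) (x : X) : \1_A x <= 1 :> R.
Proof. by rewrite indicE; case: (x \in A). Qed.

(** Comparison with the integral of the inverse square root, in telescoping form. *)
Lemma sum_inv_sqrt_le (R : realType) n :
  \sum_(1 <= j < n.+1) (Num.sqrt j%:R)^-1 <= 2 * Num.sqrt n%:R :> R.
Proof.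
elim: n => [|n IH]; first by rewrite big_geq// sqrtr0 mulr0.
rewrite big_nat_recr//=; apply: le_trans (lerD IH (lexx _)) _.
set x : R := Num.sqrt n%:R; set y : R := Num.sqrt n.+1%:R.
have y0 : 0 < y by rewrite sqrtr_gt0 ltr0n.
have x0 : 0 <= x by rewrite sqrtr_ge0.
have xy : x <= y by rewrite ler_sqrt// ler_nat.
have yx : y ^+ 2 = x ^+ 2 + 1 by rewrite !sqr_sqrtr ?ler0n// -natr1.
rewrite -(ler_pM2r y0) mulrDl mulVf ?gt_eqF//.
by nra.
Qed.

(** Each increment of [r |-> expR (mu * \sum_(i < r) a i)] is at most
[mu * a r] times its new value, and that value is in turn one plus the earlier
increments; exchanging the two sums leaves each increment multiplied by the
part of the sum that is still to come.  Applied to an occupation time, the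
increment is known at time [r], and the remaining occupation can be estimated by
conditioning. *)
Lemma expR_sum_abel (R : realType) (a : nat -> R) (mu : R) n :
  (forall i, 0 <= a i) -> 0 <= mu ->
  expR (mu * \sum_(i < n) a i) <=
  1 + mu * (\sum_(i < n) a i) +
  mu * \sum_(r < n) (expR (mu * \sum_(i < r.+1) a i) - expR (mu * \sum_(i < r) a i)) *
                   (\sum_(r <= i < n) a i).
Proof.
move=> a0 mu0; pose e r := expR (mu * \sum_(i < r) a i).
elim: n => [|n IH]; first by rewrite !big_ord0 !mulr0 !addr0 expR0.
rewrite -/(e n.+1).
have -> : \sum_(r < n.+1) (e r.+1 - e r) * (\sum_(r <= i < n.+1) a i) =
    \sum_(r < n) (e r.+1 - e r) * (\sum_(r <= i < n) a i) + (e n.+1 - 1) * a n.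
  rewrite big_ord_recr/= big_nat1.
  transitivity (\sum_(r < n) ((e r.+1 - e r) * (\sum_(r <= i < n) a i) +
     (e r.+1 - e r) * a n) + (e n.+1 - e n) * a n).
    congr (_ + _); apply: eq_bigr => r _.
    by rewrite big_nat_recr ?mulrDr//= ltnW.
  rewrite big_split/= -mulr_suml.
  have -> : \sum_(r < n) (e r.+1 - e r) = e n - 1.
    rewrite -(big_mkord xpredT (fun r => e r.+1 - e r)) telescope_sumr//.
    by rewrite {2}/e big_ord0 mulr0 expR0.
  by ring.
rewrite big_ord_recr/=.
have step : e n.+1 - e n <= mu * a n * e n.+1.
  rewrite /e big_ord_recr/= mulrDr expRD.
  set x := expR (mu * \sum_(i < n) a i); set y := mu * a n.
  have x0 : 0 < x by exact: expR_gt0.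
  have := expR_ge1Dx (- y); rewrite expRN => h.
  have y0 : 0 < expR y by exact: expR_gt0.
  have : (1 - y) * expR y <= 1 by rewrite -ler_pdivlMr// mul1r.
  move=> h2; have : x * ((1 - y) * expR y) <= x * 1 by rewrite ler_pM2l.
  by rewrite mulr1; nra.
move: IH; rewrite -/(e n); move: step; set S := \sum_(r < n) _.
move: (e n) (e n.+1) (a n) (\sum_(i < n) a i) S => x y z u v.
by nra.
Qed.

Section transforms.
Variables (R : realType) (T : R).
Local Notation W := (path_space R).
Variable N : nat.
Local Notation t := (grid T N).

Definition mesh_size : R := T / 2 ^+ N.
Local Notation dt := mesh_size.

Definition adapted (H : nat -> set W) := forall r, @measurable _ (past T (t r)) (H r).

(** The discrete stochastic integral of the indicator of [H] against the path. *)
Definition transform (H : nat -> set W) (r : nat) (w : W) : R :=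
  \sum_(i < r) \1_(H i) w * (displacement w (t i.+1) - displacement w (t i)).

(** The quadratic variation of [transform], that is, the time spent in [H]. *)
Definition clock (H : nat -> set W) (r : nat) (w : W) : R :=
  \sum_(i < r) \1_(H i) w * dt.

Lemma gridS r : t r.+1 = t r + dt.
Proof. by rewrite /grid /mesh_size -natr1 !mulrDl mul1r. Qed.

Hypothesis T0 : 0 < T.

Lemma mesh_size_gt0 : 0 < dt. Proof. by rewrite divr_gt0// exprn_gt0. Qed.

Lemma measurable_clock H r s : adapted H -> (forall i, (i < r)%N -> t i <= s) ->
  measurable_fun setT (clock H r : past T s -> R).
Proof.
move=> aH rs; apply: measurable_sum => i.
apply: measurable_funM; last exact: measurable_cst.
apply: (measurable_fun_past_le (rs i (ltn_ord i))).
exact: measurable_indic.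
Qed.

Lemma measurable_transform H r : adapted H ->
  measurable_fun setT (transform H r : past T (t r) -> R).
Proof.
move=> aH; apply: measurable_sum => i.
apply: measurable_funM.
  apply: (@measurable_fun_past_le _ _ _ _ (t i)); last exact: measurable_indic.
  by rewrite grid_le// ltnW.
apply: measurable_funB; apply: measurable_displacement_past; rewrite grid_le//.
by rewrite ltnW.
Qed.

Variables (P : probability W R) (wP : wiener_measure P).

(** The exponential martingale: given the past, one step multiplies by a factor
whose mean is one by the Gaussian moment generating function. *)
Lemma exp_transform (H : nat -> set W) (c : R) r : adapted H ->
  (\int[P]_w (expR (c * transform H r w - c ^+ 2 / 2 * clock H r w)%R)%:E = 1)%E.
Proof.
move=> aH; elim: r => [|r IH].
  under eq_integral do rewrite /transform /clock !big_ord0 !mulr0 subr0 expR0.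
  by rewrite integral_cst//= probability_setT mule1.
pose Y w := expR (c * transform H r w - c ^+ 2 / 2 * clock H r w).
(* The compensator of one step. *)
pose k := expR (- (c ^+ 2 * dt / 2)).
have mY : measurable_fun setT (Y : past T (t r) -> R).
  apply: measurableT_comp => //; apply: measurable_funB; apply: measurable_funM => //.
  - exact: measurable_transform.
  - by apply: measurable_clock => // i ir; rewrite grid_le// ltnW.
have mH : measurable_fun setT (\1_(H r) : past T (t r) -> R) by exact: measurable_indic.
have mHc : measurable_fun setT (\1_(~` H r) : past T (t r) -> R).
  by apply: measurable_indic; apply: measurableC.
pose f w := (Y w * \1_(H r) w * k)%:E.
have mf : measurable_fun setT (f : past T (t r) -> \bar R).
  apply/measurable_EFinP; apply: measurable_funM; last exact: measurable_cst.
  exact: measurable_funM.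
have f0 w : (0 <= f w)%E by rewrite lee_fin !mulr_ge0// expR_ge0.
have mg : measurable_fun setT (fun w : W => (Y w * \1_(~` H r) w)%:E).
  apply: (@measurable_fun_past _ T _ _ (t r)).
  by apply/measurable_EFinP; exact: measurable_funM.
transitivity (\int[P]_w (f w * (expR (c * (displacement w (t r.+1) - displacement w (t r)))%R)%:E
   + (Y w * \1_(~` H r) w)%:E))%E.
  apply: eq_integral => w _; rewrite -EFinM -EFinD; congr EFin.
  rewrite /f /Y /k /transform /clock !big_ord_recr/= !indicE in_setC.
  case: (w \in H r) => /=; last by rewrite !(mul0r, mulr0, mulr1, addr0, add0r).
  by rewrite !(mul1r, mulr0, mulr1, addr0) -!expRD; congr expR; ring.
have minc : measurable_fun setT (fun w : W =>
   (expR (c * (displacement w (t r.+1) - displacement w (t r))))%:E).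
  apply/measurable_EFinP; apply: measurableT_comp => //; apply: measurable_funM.
    exact: measurable_cst.
  by apply: measurable_funB; exact: measurable_displacement.
rewrite ge0_integralD//=; last 3 first.
- by move=> w _; rewrite mule_ge0// lee_fin expR_ge0.
- by apply: emeasurable_funM => //; exact: measurable_fun_past mf.
- by move=> w _; rewrite lee_fin mulr_ge0// expR_ge0.
rewrite (past_exp_increment T0 wP)//; last by rewrite grid_lt.
rewrite -ge0_integralZr//=; last exact: measurable_fun_past mf.
rewrite -ge0_integralD//=; last 3 first.
- by move=> w _; rewrite mule_ge0// lee_fin expR_ge0.
- by apply: emeasurable_funM => //; exact: measurable_fun_past mf.
- by move=> w _; rewrite lee_fin mulr_ge0// expR_ge0.
rewrite -[RHS]IH; apply: eq_integral => w _.
rewrite -EFinM -EFinD; congr EFin; rewrite /f /k -/(Y w).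
have -> : t r.+1 - t r = dt by rewrite gridS; ring.
rewrite -[X in X + _]mulrA -expRD addNr expR0 mulr1 -mulrDr.
by rewrite !indicE in_setC; case: (w \in H r); rewrite /= ?addr0 ?add0r mulr1.
Qed.

End transforms.

(** * Time spent in a strip *)

Section occupation_bound.
Variables (R : realType) (T : R) (T0 : 0 < T).
Local Notation W := (path_space R).
Variables (P : probability W R) (wP : wiener_measure P).
Variable N : nat.
Local Notation t := (grid T N).
Local Notation dt := (mesh_size T N).
Variables (a b : R) (ab : a <= b).

Definition in_strip (i : nat) : set W := [set w | displacement w (t i) \in `[a, b]].

Lemma adapted_in_strip : adapted T N in_strip.
Proof.
move=> r; rewrite -[X in measurable X]setTI.
exact: (@measurable_displacement_past R T (t r) N r (lexx _) measurableT
  `[a, b]%classic (measurable_itv _)).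
Qed.

Lemma in_stripE i w : \1_(in_strip i) w = \1_(`[a, b]%classic) (displacement w (t i)) :> R.
Proof. by rewrite !indicE. Qed.

(** Given the past at step [r], the path is in the strip after [j] more steps with
probability at most [(b - a) / sqrt (j * dt)], and these sum to a bound of order
[(b - a) * sqrt T] uniformly in [r].  The first step is counted in full. *)
Lemma future_occupation_le r (f : W -> \bar R) : (r < 2 ^ N)%N ->
  measurable_fun setT (f : past T (t r) -> \bar R) -> (forall w, 0 <= f w)%E ->
  (\int[P]_w (f w * (\sum_(r <= i < 2 ^ N) \1_(in_strip i) w * dt)%:E) <=
   \int[P]_w f w * (dt + 2 * (b - a) * Num.sqrt T)%:E)%E.
Proof.
move=> rN mf f0; set u := (\int[P]_w f w)%E.
have dt0 := mesh_size_gt0 N T0.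
have mfW := measurable_fun_past mf.
have u0 : (0 <= u)%E by apply: integral_ge0.
pose c i := if i == r then dt else dt * ((b - a) / Num.sqrt (t i - t r)).
have mi i : measurable_fun setT (fun w : W => (\1_(in_strip i) w * dt)%:E).
  apply/measurable_EFinP; apply: measurable_funM; last exact: measurable_cst.
  by apply: measurable_indic; apply: (@measurable_past _ T (t i)); exact: adapted_in_strip.
have le1 i : (r <= i)%N -> (\int[P]_w (f w * (\1_(in_strip i) w * dt)%:E) <= u * (c i)%:E)%E.
  rewrite leq_eqVlt => /orP[/eqP <-|ri].
    rewrite /c eqxx -ge0_integralZr//=; last by rewrite lee_fin ltW.
    apply: ge0_le_integral => //=.
    - by move=> w _; rewrite mule_ge0// lee_fin mulr_ge0// ltW.
    - exact: emeasurable_funM.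
    - exact: emeasurable_funM.
    - move=> w _; apply: lee_wpmul2l => //; rewrite lee_fin.
      by apply: ler_piMl; [exact: ltW|exact: indic_le1].
  rewrite /c gtn_eqF// EFinM muleCA.
  under eq_integral do rewrite EFinM muleA.
  rewrite ge0_integralZr//=; last 3 first.
  - apply: emeasurable_funM => //; apply/measurable_EFinP; apply: measurable_indic.
    by apply: (@measurable_past _ T (t i)); exact: adapted_in_strip.
  - by move=> w _; rewrite mule_ge0// lee_fin.
  - by rewrite lee_fin ltW.
  rewrite muleC; apply: lee_wpmul2l; first by rewrite lee_fin ltW.
  under eq_integral do rewrite in_stripE.
  by apply: past_itv_le => //; rewrite grid_lt.
under eq_integral.
  move=> w _; rewrite -sumEFin ge0_sume_distrr; last first.
    by move=> i _; rewrite lee_fin mulr_ge0// ltW.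
  over.
rewrite ge0_integral_sum//=; last 2 first.
- by move=> i; exact: emeasurable_funM.
- by move=> i w _; rewrite mule_ge0// lee_fin mulr_ge0// ltW.
have c0 i : 0 <= c i.
  rewrite /c; case: ifP => _; first exact: ltW.
  by rewrite mulr_ge0 ?(ltW dt0)// divr_ge0 ?sqrtr_ge0// subr_ge0.
apply: (@le_trans _ _ (\sum_(r <= i < 2 ^ N) u * (c i)%:E)%E).
  rewrite big_nat_cond [leRHS]big_nat_cond; apply: lee_sum => i.
  by rewrite andbT => /andP[ri _]; exact: le1.
rewrite -ge0_sume_distrr; last by move=> i _; rewrite lee_fin.
apply: lee_wpmul2l => //; rewrite sumEFin lee_fin.
rewrite big_ltn// {1}/c eqxx lerD2l.
apply: (@le_trans _ _ (\sum_(1 <= j < (2 ^ N).+1) (b - a) * Num.sqrt dt * (Num.sqrt j%:R)^-1)).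
  (* Reindex by the number of steps elapsed. *)
  rewrite -add1n big_addn.
  apply: (@le_trans _ _ (\sum_(1 <= j < 2 ^ N - r) (b - a) * Num.sqrt dt * (Num.sqrt j%:R)^-1)).
    rewrite big_nat_cond [leRHS]big_nat_cond; apply: ler_sum => j.
    rewrite andbT => /andP[j1 _].
    rewrite /c -{2}[r]add0n eqn_add2r gtn_eqF//.
    have -> : t (j + r) - t r = j%:R * dt.
      by rewrite /grid /mesh_size natrD -mulrBl -mulrBl addrK mulrA.
    rewrite sqrtrM// -{1}(sqr_sqrtr (ltW dt0)).
    have j0 : Num.sqrt j%:R != 0 :> R by rewrite gt_eqF// sqrtr_gt0 ltr0n.
    have d0 : Num.sqrt dt != 0 :> R by rewrite gt_eqF// sqrtr_gt0.
    rewrite le_eqVlt; apply/orP; left; apply/eqP; field.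
    by rewrite j0 d0.
  have [n1|n1] := leqP 1 (2 ^ N - r); last first.
    rewrite big_geq//; first by apply: sumr_ge0 => j _; rewrite !mulr_ge0 ?sqrtr_ge0 ?invr_ge0 ?sqrtr_ge0 ?subr_ge0.
    by rewrite -ltnS ltnW.
  rewrite [leRHS](big_cat_nat n1) /=; last by rewrite (leq_trans (leq_subr _ _)).
  by rewrite lerDl; apply: sumr_ge0 => j _; rewrite !mulr_ge0 ?sqrtr_ge0 ?invr_ge0 ?sqrtr_ge0 ?subr_ge0.
rewrite -mulr_sumr.
have -> : Num.sqrt T = Num.sqrt dt * Num.sqrt (2 ^ N)%:R.
  rewrite -sqrtrM ?(ltW dt0)//; congr Num.sqrt.
  by rewrite /mesh_size natrX divfK// expf_neq0.
rewrite [2 * _]mulrC -!mulrA ler_wpM2l ?subr_ge0//.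
rewrite mulrCA ler_wpM2l ?sqrtr_ge0//.
exact: sum_inv_sqrt_le.
Qed.

(** Khasminskii's lemma: if the expected remaining occupation, given any past, is
at most [K] and [mu * K <= 1 / 2], then [X = E (expR (mu * A))] satisfies
[X <= 1 + mu * K * X <= 1 + X / 2], hence [X <= 2]. *)
Lemma exp_clock_le2 (mu : R) : 0 <= mu ->
  mu * (dt + 2 * (b - a) * Num.sqrt T) <= 2^-1 ->
  (\int[P]_w (expR (mu * clock T N in_strip (2 ^ N) w))%:E <= 2%:E)%E.
Proof.
move=> mu0; set K := dt + _ => muK; set n := (2 ^ N)%N.
have dt0 := mesh_size_gt0 N T0.
have K0 : 0 <= K.
  by rewrite /K addr_ge0 ?(ltW dt0)// !mulr_ge0 ?sqrtr_ge0// subr_ge0.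
pose A r w := clock T N in_strip r w.
pose D r w := expR (mu * A r.+1 w) - expR (mu * A r w).
pose F r w := \sum_(r <= i < n) \1_(in_strip i) w * dt.
have A_le r w : A r w <= A r.+1 w.
  by rewrite /A /clock big_ord_recr/= lerDl mulr_ge0// ltW.
have D0 r w : 0 <= D r w by rewrite subr_ge0 ler_expR ler_wpM2l.
have F0 r w : 0 <= F r w by apply: sumr_ge0 => i _; rewrite mulr_ge0// ltW.
have mA r s : (forall i, (i < r)%N -> t i <= s) ->
    measurable_fun setT (A r : past T s -> R).
  by apply: measurable_clock; exact: adapted_in_strip.
have mEA r s : (forall i, (i < r)%N -> t i <= s) ->
    measurable_fun setT ((fun w => expR (mu * A r w)) : past T s -> R).
  move=> rs; apply: measurableT_comp => //; apply: measurable_funM; last exact: mA.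
  exact: measurable_cst.
have mD r : measurable_fun setT (D r : past T (t r) -> R).
  by apply: measurable_funB; apply: mEA => i ir; rewrite grid_le// ltnW.
have mF r : measurable_fun setT (F r : W -> R).
  apply: measurable_sum => i; apply: measurable_funM; last exact: measurable_cst.
  by apply: measurable_indic; apply: (@measurable_past _ T (t i)); exact: adapted_in_strip.
have mDW r : measurable_fun setT (D r : W -> R) := measurable_fun_past (mD r).
have mEW r : measurable_fun setT ((fun w => expR (mu * A r w)) : W -> R).
  apply: (@measurable_fun_past _ T _ _ (t r)); apply: mEA => i ir.
  by rewrite grid_le// ltnW.
(* Telescope [expR (mu * A n)]: index 0 carries the initial value 1, and its
   remaining occupation is the whole of it. *)
pose g r w : R := if r is r'.+1 then D r' w else 1.
pose G r w : R := if r is r'.+1 then F r' w else F 0%N w.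
have g0 r w : 0 <= g r w by case: r => [|r]; [exact: ler01|exact: D0].
have G0 r w : 0 <= G r w by case: r => [|r]; exact: F0.
have mg r : measurable_fun setT (g r : W -> R) by case: r => [|r]; [exact: measurable_cst|exact: mDW].
have mG r : measurable_fun setT (G r : W -> R) by case: r => [|r]; exact: mF.
have gsum w : \sum_(r < n.+1) g r w = expR (mu * A n w).
  rewrite big_ord_recl/= -(big_mkord xpredT (fun r => D r w)) /D.
  rewrite (telescope_sumr (fun r => expR (mu * A r w)))//.
  by rewrite {2}/A /clock big_ord0 mulr0 expR0 addrC subrK.
have ptw w : expR (mu * A n w) <= 1 + \sum_(r < n.+1) mu * (g r w * G r w).
  have := @expR_sum_abel R (fun i => \1_(in_strip i) w * dt) mu n _ mu0.
  move=> /(_ (fun i => mulr_ge0 (ler0n _ _) (ltW dt0))).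
  rewrite big_ord_recl/= mul1r -mulr_sumr /F big_mkord addrA; exact.
set X := (\int[P]_w _)%E.
have Xsum : X = (\sum_(r < n.+1) \int[P]_w (g r w)%:E)%E.
  rewrite -ge0_integral_sum//=; last 2 first.
  - by move=> r; apply/measurable_EFinP.
  - by move=> r w _; rewrite lee_fin.
  by apply: eq_integral => w _; rewrite sumEFin gsum.
have key (r : 'I_n.+1) : (\int[P]_w (mu * (g r w * G r w))%:E <=
    (mu * K)%:E * \int[P]_w (g r w)%:E)%E.
  under eq_integral do rewrite EFinM EFinM.
  rewrite ge0_integralZl//=; last 2 first.
  - by apply: emeasurable_funM; apply/measurable_EFinP.
  - by move=> w _; rewrite mule_ge0// lee_fin.
  rewrite EFinM -muleA; apply: lee_wpmul2l; first by rewrite lee_fin.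
  rewrite muleC; case: r => -[|r] /= rn.
    apply: (@future_occupation_le 0 (fun=> 1%E)) => //.
    by rewrite expn_gt0.
  apply: (@future_occupation_le r (fun w => (D r w)%:E)) => //.
    by apply/measurable_EFinP.
  by move=> w; rewrite lee_fin.
have XK : (X <= 1 + (2^-1)%:E * X)%E.
  apply: (@le_trans _ _ (\int[P]_w (1 + \sum_(r < n.+1) (mu * (g r w * G r w))%:E))%E).
    apply: ge0_le_integral => //=.
    - by apply/measurable_EFinP; exact: mEW.
    - apply: emeasurable_funD; first exact: measurable_cst.
      apply: emeasurable_sum => r; apply/measurable_EFinP.
      apply: measurable_funM; first exact: measurable_cst.
      exact: measurable_funM.
    - by move=> w _; rewrite sumEFin -EFinD lee_fin; exact: ptw.
  rewrite ge0_integralD//=; last 2 first.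
  - by move=> w _; apply: sume_ge0 => r _; rewrite lee_fin !mulr_ge0.
  - apply: emeasurable_sum => r; apply/measurable_EFinP.
    apply: measurable_funM; first exact: measurable_cst.
    exact: measurable_funM.
  rewrite integral_cst//= probability_setT mule1 leeD2l//.
  rewrite ge0_integral_sum//=; last 2 first.
  - move=> r; apply/measurable_EFinP.
    apply: measurable_funM; first exact: measurable_cst.
    exact: measurable_funM.
  - by move=> r w _; rewrite lee_fin !mulr_ge0.
  apply: (@le_trans _ _ (\sum_(r < n.+1) (mu * K)%:E * \int[P]_w (g r w)%:E)%E).
    by apply: lee_sum => r _; exact: key.
  rewrite -ge0_sume_distrr; last first.
    by move=> r _; apply: integral_ge0 => w _; rewrite lee_fin.
  rewrite -Xsum; apply: lee_wpmul2r; last by rewrite lee_fin.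
  by apply: integral_ge0 => w _; rewrite lee_fin expR_ge0.
have Xfin : X \is a fin_num.
  rewrite ge0_fin_numE; last by apply: integral_ge0 => w _; rewrite lee_fin expR_ge0.
  apply: (@le_lt_trans _ _ (expR (mu * (n%:R * dt)))%:E); last exact: ltry.
  apply: (@le_trans _ _ (\int[P]_w (cst (expR (mu * (n%:R * dt)))%:E w))%E).
    apply: ge0_le_integral => //=.
    - by apply/measurable_EFinP; exact: mEW.
    - move=> w _; rewrite lee_fin ler_expR ler_wpM2l// /clock.
      apply: (@le_trans _ _ (\sum_(i < n) dt)).
        by apply: ler_sum => i _; apply: ler_piMl; [exact: ltW|exact: indic_le1].
      by rewrite sumr_const card_ord mulr_natl.
  by rewrite integral_cst//= probability_setT mule1.
(* Subtracting [X / 2] is legitimate because the clock is bounded. *)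
move: XK; rewrite -(fineK Xfin) -EFinM -EFinD !lee_fin; lra.
Qed.

End occupation_bound.

(** * Moments from exponential tails *)

Lemma powR_le_expR_half (R : realType) (p : R) : 0 <= p -> exists2 C : R, 0 < C &
  forall y, 0 <= y -> y `^ p <= C * expR (y / 2).
Proof.
(* Dominate by an integer power, which is a term of the exponential series. *)
move=> p0; have [n pn] : exists n, p <= n.+1%:R.
  by exists (Num.truncn p); exact/ltW/truncnS_gt.
have C0 : 0 < (n.+1)`!%:R * 2 ^+ n.+1 :> R.
  by rewrite mulr_gt0 ?exprn_gt0// ltr0n fact_gt0.
exists (1 + (n.+1)`!%:R * 2 ^+ n.+1) => [|y y0]; first by rewrite addr_gt0.
have e1 : 1 <= expR (y / 2) by rewrite -expR0 ler_expR divr_ge0.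
have [y1|y1] := leP y 1.
  apply: (@le_trans _ _ 1).
    have -> : 1 = 1 `^ p :> R by rewrite powR1.
    by apply: ge0_ler_powR; rewrite ?nnegrE.
  by rewrite -[leLHS]mulr1 ler_pM// lerDl; exact: ltW.
apply: (@le_trans _ _ (y ^+ n.+1)).
  by rewrite -powR_mulrn// ler_powR// ltW.
have := @expR_ge1Dxn R (y / 2) n (divr_ge0 y0 (ler0n _ _)).
set F := (n.+1)`!%:R; have F0 : 0 < F by rewrite ltr0n fact_gt0.
rewrite expr_div_n => h.
have {}h : y ^+ n.+1 / 2 ^+ n.+1 / F <= expR (y / 2) by lra.
move: h; rewrite !ler_pdivrMr ?exprn_gt0// => h.
have e0 := expR_ge0 (y / 2).
by rewrite mulrDl mul1r; lra.
Qed.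

(** The term of index the integer part of [y] alone is at least the left-hand side. *)
Lemma expR_half_le_sum (R : realType) (y : R) : 0 <= y ->
  ((expR (y / 2))%:E <=
   \sum_(0 <= k <oo) (expR (k.+1%:R / 2) * ((k%:R <= y)%R : nat)%:R)%:E)%E.
Proof.
move=> y0; set k := Num.truncn y.
have ky : k%:R <= y by rewrite truncn_le.
have yk : y < k.+1%:R by exact: truncnS_gt.
have h0 i : (0 <= (expR (i.+1%:R / 2) * ((i%:R <= y)%R : nat)%:R)%:E)%E.
  by rewrite lee_fin mulr_ge0 ?expR_ge0.
apply: (@le_trans _ _ (\sum_(0 <= i < k.+1) (expR (i.+1%:R / 2) * ((i%:R <= y)%R : nat)%:R)%:E)%E).
  rewrite big_nat_recr//= ky mulr1; apply: (@le_trans _ _ (expR (k.+1%:R / 2))%:E).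
    by rewrite lee_fin ler_expR ler_pM2r// ltW.
  by rewrite leeDr// sume_ge0.
by apply: nneseries_lim_ge => i _.
Qed.

Lemma nneseries_geometric_le (R : realType) (r : R) : 0 <= r < 1 ->
  (\sum_(0 <= k <oo) (r ^+ k)%:E <= ((1 - r)^-1)%:E)%E.
Proof.
move=> /andP[r0 r1]; have r10 : 0 < 1 - r by rewrite subr_gt0.
apply: lime_le; first by apply: is_cvg_nneseries => n _ _; rewrite lee_fin exprn_ge0.
near=> n; rewrite sumEFin lee_fin big_mkord.
rewrite -[leRHS]mul1r ler_pdivlMr// mulrC.
have := subrX1 r n => h.
have -> : (1 - r) * \sum_(i < n) r ^+ i = 1 - r ^+ n.
  by rewrite -[1 - r]opprB mulNr -h opprB.
by rewrite gerBl exprn_ge0.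
Unshelve. all: by end_near. Qed.

(** An exponential tail controls all moments, with a constant that depends on the
exponent only: [y `^ p] is dominated by [expR (y / 2)], which is dominated by a
sum of indicators of tail events. *)
Lemma moment_of_tail (R : realType) (p : R) : 0 <= p -> exists2 C : R, 0 < C &
  forall d (Om : measurableType d) (P : probability Om R) (Y : Om -> R) (B : R),
    measurable_fun setT Y -> (forall w, 0 <= Y w) -> 0 <= B ->
    (forall k : nat, (P [set w | (k%:R <= Y w)%R] <= (B * expR (- k%:R))%:E)%E) ->
    (\int[P]_w (Y w `^ p)%:E <= (C * B)%:E)%E.
Proof.
move=> p0; have [C C0 hC] := powR_le_expR_half p0.
pose r : R := expR (- 2^-1).
have r01 : 0 <= r < 1 by rewrite expR_ge0/= -expR0 ltr_expR oppr_lt0.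
have r10 : 0 < 1 - r by rewrite subr_gt0; case/andP: r01.
exists (C * (expR (2^-1) * (1 - r)^-1)) => [|d Om P Y B mY Y0 B0 tail].
  by rewrite !mulr_gt0 ?expR_gt0 ?invr_gt0.
have mE k : measurable [set w | k%:R <= Y w].
  rewrite (_ : [set w | _] = Y @^-1` `[k%:R, +oo[%classic); last first.
    by rewrite predeqE => w; rewrite /= in_itv/= andbT.
  by rewrite -[X in measurable X]setTI; exact: mY.
pose f k w : \bar R := ((expR (k.+1%:R / 2))%:E * (\1_[set w | (k%:R <= Y w)%R] w)%:E)%E.
have f0 k w : (0 <= f k w)%E by rewrite mule_ge0// lee_fin expR_ge0.
have mf k : measurable_fun setT (f k).
  apply: emeasurable_funM; first exact: measurable_cst.
  by apply/measurable_EFinP; exact: measurable_indic.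
have mser : measurable_fun setT (fun w => (\sum_(0 <= k <oo) f k w)%E).
  by apply: ge0_emeasurable_sum.
apply: (@le_trans _ _ (\int[P]_w (C%:E * \sum_(0 <= k <oo) f k w))%E).
  apply: ge0_le_integral => //=.
  - by move=> w _; rewrite lee_fin powR_ge0.
  - by apply/measurable_EFinP; exact: (measurableT_comp (measurable_powR p) mY).
  - by apply: emeasurable_funM => //; exact: measurable_cst.
  - move=> w _; apply: (@le_trans _ _ (C%:E * (expR (Y w / 2))%:E)%E).
      by rewrite -EFinM lee_fin hC.
    apply: lee_wpmul2l; first by rewrite lee_fin ltW.
    apply: le_trans (expR_half_le_sum (Y0 w)) _.
    rewrite le_eqVlt; apply/orP; left; apply/eqP; apply: eq_eseriesr => k _.
    rewrite /f -EFinM indicE; congr (_ * _)%:E; congr (nat_of_bool _)%:R.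
    by apply/idP/idP; rewrite inE.
rewrite ge0_integralZl//=; last 2 first.
- by move=> w _; apply: nneseries_ge0.
- by rewrite lee_fin ltW.
rewrite -mulrA EFinM; apply: lee_wpmul2l; first by rewrite lee_fin ltW.
rewrite integral_nneseries//.
apply: (@le_trans _ _ (\sum_(0 <= k <oo) ((B * expR 2^-1)%:E * (r ^+ k)%:E))%E).
  apply: lee_nneseries => [k _ _|k _]; first exact: integral_ge0.
  rewrite /f ge0_integralZl//=; last by apply/measurable_EFinP; exact: measurable_indic.
  rewrite integral_indic//= setIT.
  apply: (@le_trans _ _ ((expR (k.+1%:R / 2))%:E * (B * expR (- k%:R))%:E)%E).
    by apply: lee_wpmul2l; [rewrite lee_fin expR_ge0|exact: tail].
  rewrite -!EFinM lee_fin mulrCA -mulrA ler_wpM2l//.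
  rewrite /r -expRM_natl -!expRD ler_expR -natr1 mulr_natl -mulr_natr; lra.
rewrite nneseriesZl; last by move=> k _; rewrite lee_fin exprn_ge0// expR_ge0.
apply: (@le_trans _ _ ((B * expR 2^-1)%:E * ((1 - r)^-1)%:E)%E).
  apply: lee_wpmul2l; first by rewrite lee_fin mulr_ge0// expR_ge0.
  exact: nneseries_geometric_le.
by rewrite -EFinM lee_fin; lra.
Qed.

(** * The running maximum of a transform *)

Section running_maximum.
Variables (R : realType) (T : R) (T0 : 0 < T).
Local Notation W := (path_space R).
Variables (P : probability W R) (wP : wiener_measure P).
Variable N : nat.
Local Notation t := (grid T N).
Local Notation transform := (transform T N).
Local Notation clock := (clock T N).
Local Notation adapted := (adapted T N).

(** Write [expR (c * M)] as the product of a square root of the exponential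
martingale with parameter [2 * c] and of [expR (c ^+ 2 * A)], and apply
[2 * u * v <= u ^+ 2 + v ^+ 2]. *)
Lemma exp_transform_le (H : nat -> set W) (c C0 : R) r : adapted H ->
  (\int[P]_w (expR (2 * c ^+ 2 * clock H r w))%:E <= C0%:E)%E ->
  (\int[P]_w (expR (c * transform H r w))%:E <= ((1 + C0) / 2)%:E)%E.
Proof.
move=> aH hC.
have mA : measurable_fun setT (clock H r : W -> R).
  apply: (@measurable_fun_past _ T _ _ (t r)); apply: measurable_clock => // i ir.
  by rewrite grid_le// ltnW.
have mM : measurable_fun setT (transform H r : W -> R).
  by apply: (@measurable_fun_past _ T _ _ (t r)); exact: measurable_transform.
pose f w : \bar R := (expR ((2 * c) * transform H r w - (2 * c) ^+ 2 / 2 * clock H r w))%:E.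
pose g w : \bar R := (expR (2 * c ^+ 2 * clock H r w))%:E.
have mf : measurable_fun setT f.
  apply/measurable_EFinP; apply: measurableT_comp => //; apply: measurable_funB.
    by apply: measurable_funM => //; exact: measurable_cst.
  by apply: measurable_funM => //; exact: measurable_cst.
have mg : measurable_fun setT g.
  apply/measurable_EFinP; apply: measurableT_comp => //.
  by apply: measurable_funM => //; exact: measurable_cst.
apply: (@le_trans _ _ (\int[P]_w ((2^-1)%:E * (f w + g w)))%E).
  apply: ge0_le_integral => //=.
  - apply/measurable_EFinP; apply: measurableT_comp => //.
    by apply: measurable_funM => //; exact: measurable_cst.
  - apply: emeasurable_funM; first exact: measurable_cst.
    exact: emeasurable_funD.
  - move=> w _; rewrite /f /g -EFinD -EFinM lee_fin.
    set x := transform H r w; set y := clock H r w.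
    have -> : expR (c * x) = expR (c * x - c ^+ 2 * y) * expR (c ^+ 2 * y).
      by rewrite -expRD subrK.
    have -> : expR (2 * c * x - (2 * c) ^+ 2 / 2 * y) = expR (c * x - c ^+ 2 * y) ^+ 2.
      by rewrite [RHS]expr2 -expRD; congr expR; field.
    have -> : expR (2 * c ^+ 2 * y) = expR (c ^+ 2 * y) ^+ 2.
      by rewrite [RHS]expr2 -expRD; congr expR; ring.
    move: (expR _) (expR _) => u v.
    by have := sqr_ge0 (u - v); nra.
rewrite ge0_integralZl//=; last 2 first.
- exact: emeasurable_funD.
- by move=> w _; rewrite adde_ge0// lee_fin expR_ge0.
rewrite ge0_integralD//=; last 2 first.
- by move=> w _; rewrite lee_fin expR_ge0.
- by move=> w _; rewrite lee_fin expR_ge0.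
rewrite (exp_transform T0 wP)// mulrC EFinM EFinD; apply: lee_wpmul2l.
  by rewrite lee_fin.
exact: leeD2l.
Qed.

(** Restricting [H] to the steps before the transform first reaches [lam] in
absolute value freezes the transform from then on. *)
Definition stopped (H : nat -> set W) (lam : R) (r : nat) : set W :=
  H r `&` [set w | forall i, (i <= r)%N -> `|transform H i w| < lam].

Lemma adapted_stopped H lam : adapted H -> adapted (stopped H lam).
Proof.
move=> aH r; apply: measurableI => //.
set Om := past T (t r).
rewrite [X in measurable X](_ : _ = \bigcap_i (if (i <= r)%N then
   (fun w : Om => `|transform H i w|) @^-1` `]-oo, lam[%classic else setT)); last first.
  rewrite predeqE => w; split => [h i _|h i ir].
    by case: ifPn => // ir; rewrite /= in_itv/= h.
  by have := h i I; rewrite ir /= in_itv.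
apply: bigcapT_measurable => i; case: ifPn => // ir.
rewrite -[X in measurable X]setTI.
apply: measurableT_comp (measurableT) _ (measurable_itv _) => //.
apply: (@measurable_fun_past_le _ _ _ _ (t i)); first by rewrite grid_le.
exact: measurable_transform.
Qed.

(** If the transform ever reaches [lam], the stopped transform keeps the first such
value until the end.  This replaces a maximal inequality: the running maximum is large
only if the final value of another transform, with a smaller clock, is. *)
Lemma stopped_transform H lam n w r : (r <= n)%N -> lam <= `|transform H r w| ->
  lam <= `|transform (stopped H lam) n w|.
Proof.
elim: r {-2}r (leqnn r) => [|m IH] r rm rn lamr.
  move: rm lamr; rewrite leqn0 => /eqP ->.
  by rewrite /transform big_ord0 normr0 => /le_trans; apply.
have [/existsP[i /= hi]|/existsPn h] := boolP [exists i : 'I_r, lam <= `|transform H i w|].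
  apply: (IH i) => //; last by rewrite (leq_trans _ rn)// ltnW.
  by rewrite -ltnS (leq_trans (ltn_ord i)).
suff -> : transform (stopped H lam) n w = transform H r w by [].
rewrite /transform -(subnKC rn) big_split_ord/= [X in _ + X]big1 ?addr0; last first.
  move=> i _; rewrite indicE memNset ?mul0r//= => -[_ /(_ r)].
  by rewrite leq_addr => /(_ isT); rewrite ltNge lamr.
apply: eq_bigr => i _; congr (_ * _); rewrite !indicE; congr (nat_of_bool _)%:R.
apply/idP/idP; rewrite !inE; first by case.
move=> Hi; split => // j ji.
have jr : (j < r)%N by rewrite (leq_ltn_trans ji).
by have := h (Ordinal jr); rewrite -ltNge.
Qed.

Definition running_max (H : nat -> set W) (n : nat) (w : W) : R :=
  \big[Num.max/0]_(i < n.+1) `|transform H i w|.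

Lemma running_max_ge0 H n w : 0 <= running_max H n w.
Proof. exact: bigmax_ge_id. Qed.

Lemma le_running_max H n w r : (r <= n)%N -> `|transform H r w| <= running_max H n w.
Proof.
rewrite -ltnS => rn.
exact: (@le_bigmax _ _ _ 0 (fun i : 'I_n.+1 => `|transform H i w|) (Ordinal rn)).
Qed.

Lemma measurable_running_max H n : adapted H ->
  measurable_fun setT (running_max H n).
Proof.
move=> aH.
have mM i : measurable_fun setT (fun w : W => `|transform H i w|).
  apply: measurableT_comp => //.
  by apply: (@measurable_fun_past _ T _ _ (t i)); exact: measurable_transform.
suff h k (F : nat -> W -> R) : (forall i, measurable_fun setT (F i)) ->
    measurable_fun setT (fun w => \big[Num.max/0]_(i < k) F i w).
  exact: (h n.+1 (fun i w => `|transform H i w|)).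
elim: k F => [|k IH] F mF.
  by under eq_fun do rewrite big_ord0; exact: measurable_cst.
under eq_fun do rewrite big_ord_recl.
apply: measurable_maxr; first exact: mF.
exact: (IH (fun i => F (bump 0 i))).
Qed.

(** By [stopped_transform] it suffices to bound the final value of the stopped
transform, and Markov's inequality for both signs does so. *)
Lemma running_max_tail H n (c lam C0 : R) : adapted H -> 0 < c -> 0 <= lam ->
  (\int[P]_w (expR (2 * c ^+ 2 * clock H n w))%:E <= C0%:E)%E ->
  (P [set w | (lam <= c * running_max H n w)%R] <= ((1 + C0) * expR (- lam))%:E)%E.
Proof.
move=> aH c0 lam0 hC; set K := stopped H (lam / c).
have aK : adapted K by exact: adapted_stopped.
have hK : (\int[P]_w (expR (2 * c ^+ 2 * clock K n w))%:E <= C0%:E)%E.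
  apply: le_trans hC; apply: ge0_le_integral => //=.
  - apply/measurable_EFinP; apply: measurableT_comp => //.
    apply: measurable_funM; first exact: measurable_cst.
    apply: (@measurable_fun_past _ T _ _ (t n)); apply: measurable_clock => // i ir.
    by rewrite grid_le// ltnW.
  - apply/measurable_EFinP; apply: measurableT_comp => //.
    apply: measurable_funM; first exact: measurable_cst.
    apply: (@measurable_fun_past _ T _ _ (t n)); apply: measurable_clock => // i ir.
    by rewrite grid_le// ltnW.
  - have c2 : 0 <= 2 * c ^+ 2 by rewrite mulr_ge0// sqr_ge0.
    move=> w _; rewrite lee_fin ler_expR ler_wpM2l//.
    apply: ler_sum => i _; rewrite ler_wpM2r ?(ltW (mesh_size_gt0 N T0))//.
    rewrite !indicE ler_nat; case: (boolP (w \in K i)) => //.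
    by rewrite inE => -[Hi _]; rewrite mem_set.
have mK : measurable_fun setT (transform K n : W -> R).
  by apply: (@measurable_fun_past _ T _ _ (t n)); exact: measurable_transform.
have mEK (e : R) : measurable_fun setT (fun w : W => (expR (e * transform K n w))%:E).
  apply/measurable_EFinP; apply: measurableT_comp => //.
  by apply: measurable_funM => //; exact: measurable_cst.
set S := [set w | _].
have mS : measurable S.
  rewrite (_ : S = (fun w => c * running_max H n w) @^-1` `[lam, +oo[%classic); last first.
    by rewrite predeqE => w; rewrite /= in_itv/= andbT.
  rewrite -[X in measurable X]setTI.
  apply: (measurable_funM (measurable_cst c) (measurable_running_max n aH)) => //.
have -> : P S = (\int[P]_w (\1_S w)%:E)%E by rewrite integral_indic//= setIT.
apply: (@le_trans _ _ (\int[P]_w ((expR (- lam))%:E *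
   ((expR (c * transform K n w))%:E + (expR (- c * transform K n w))%:E)))%E).
  apply: ge0_le_integral => //=.
  - by apply/measurable_EFinP; exact: measurable_indic.
  - apply: emeasurable_funM; first exact: measurable_cst.
    exact: emeasurable_funD.
  - move=> w _; rewrite -EFinD -EFinM lee_fin.
    have [wS|wS] := pselect (S w); last first.
      by rewrite indicE memNset// mulr_ge0 ?expR_ge0// addr_ge0 ?expR_ge0.
    have lamK : lam <= c * `|transform K n w|.
      rewrite mulrC -ler_pdivrMr//.
      move: wS; rewrite /S /= mulrC -ler_pdivrMr// /running_max => /bigmax_geP[l0|[i _ hi]].
        by apply: (@stopped_transform H _ n w 0) => //; rewrite (le_trans l0).
      by apply: (@stopped_transform H _ n w i) => //; rewrite -ltnS.
    rewrite indicE mem_set// mulrDr -!expRD.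
    have [x0|x0] := leP 0 (transform K n w).
      rewrite ger0_norm// in lamK.
      by rewrite -[leLHS]addr0 lerD ?expR_ge0// -expR0 ler_expR; lra.
    rewrite ltr0_norm// in lamK.
    by rewrite -[leLHS]add0r lerD ?expR_ge0// -expR0 ler_expR; lra.
rewrite ge0_integralZl//=; last 2 first.
- exact: emeasurable_funD.
- by move=> w _; rewrite adde_ge0// lee_fin expR_ge0.
rewrite mulrC EFinM; apply: lee_wpmul2l; first by rewrite lee_fin expR_ge0.
rewrite ge0_integralD//=.
apply: (@le_trans _ _ (((1 + C0) / 2)%:E + ((1 + C0) / 2)%:E)%E); last first.
  by rewrite -EFinD lee_fin; lra.
apply: leeD; first exact: exp_transform_le.
by apply: exp_transform_le; [exact: aK|rewrite sqrrN].
Qed.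

End running_maximum.

(** The form used below: [c^-1] is the typical size of the transform, and all its
moments are controlled by one exponential moment of the clock at scale
[c ^- 2]. *)
Lemma running_max_moment (R : realType) (p : R) : 0 <= p -> exists2 C : R, 0 < C &
  forall (T : R) (P : probability (path_space R) R) N H n (c C0 : R),
    0 < T -> wiener_measure P -> adapted T N H -> 0 < c -> 0 <= C0 ->
    (\int[P]_w (expR (2 * c ^+ 2 * clock T N H n w))%:E <= C0%:E)%E ->
    (\int[P]_w ((running_max T N H n w) `^ p)%:E <= (C * (1 + C0) * c^-1 `^ p)%:E)%E.
Proof.
move=> p0; have [C C_gt0 hC] := moment_of_tail p0.
exists C => // T P N H n c C0 T0 wP aH c0 C00 hc.
have mM := measurable_running_max T0 n aH.
have h := hC _ _ P (fun w => c * running_max T N H n w) (1 + C0) _ _ _ _.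
under eq_integral.
  move=> w _; rewrite -[running_max _ _ _ _ _](mulKf (lt0r_neq0 c0)) powRM; last 2 first.
  - by rewrite invr_ge0 ltW.
  - by rewrite mulr_ge0 ?running_max_ge0// ltW.
  rewrite EFinM; over.
rewrite ge0_integralZl//=; last 3 first.
- apply/measurable_EFinP; apply: (measurableT_comp (measurable_powR p)).
  by apply: measurable_funM => //; exact: measurable_cst.
- by move=> w _; rewrite lee_fin powR_ge0.
- by rewrite lee_fin powR_ge0.
rewrite EFinM [leLHS]muleC; apply: lee_wpmul2r; first by rewrite lee_fin powR_ge0.
apply: h.
- by apply: measurable_funM => //; exact: measurable_cst.
- by move=> w; rewrite mulr_ge0 ?running_max_ge0// ltW.
- by rewrite addr_ge0.
- by move=> k; apply: running_max_tail.
Qed.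

(** * The embedded walk along a continuous path *)

(** Negative times are sent to the value at 0, so continuity on the half-line gives
continuity on the real line. *)
Lemma brownian_continuous (R : realType) (w : path_space R) :
  continuous (brownian w : R -> R).
Proof.
have cins : continuous (fun t : R => insubd (half_line0 R) t : half_line R).
  apply: continuous_comp_initial.
  rewrite (_ : _ \o _ = fun t : R => (t + `|t|) / 2).
    move=> t; apply: cvgM; last exact: cvg_cst.
    by apply: cvgD; [exact: cvg_id|apply: cvg_norm; exact: cvg_id].
  apply/funext => t /=; rewrite -[set_val _]/(\val _) val_insubd.
  have [t0|t0] := leP 0 t.
    by rewrite mem_set/= ?in_itv/= ?t0// ger0_norm//; field.
  rewrite memNset/= ?in_itv/= ?leNgt ?t0// ltr0_norm// subrr mul0r //.
move=> t; apply: (@continuous_comp _ _ _ (fun t : R => insubd (half_line0 R) t : half_line R)).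
  exact: cins.
exact: cts_fun.
Qed.

Section first_exit.
Variables (R : realType) (X : R -> R) (cX : continuous X) (s h : R) (h0 : 0 < h).

Let exits := [set t : R | s < t /\ `|X t - X s| = h].

Lemma continuous_gap : continuous (fun t => `|X t - X s|).
Proof.
move=> t; apply: cvg_norm; apply: cvgB; [exact: cX|exact: cvg_cst].
Qed.

(** Intermediate value theorem: the gap cannot reach [h] without an exit. *)
Lemma before_exit t : s <= t -> (forall u, exits u -> t < u) -> `|X t - X s| < h.
Proof.
move=> st noexit; rewrite ltNge; apply/negP => ht.
have [||c] := @IVT R (fun t => `|X t - X s|) s t h st.
- by apply: continuous_subspaceT => ?; exact: continuous_gap.
- by rewrite subrr normr0 ge_min le_max (ltW h0) ht orbT.
rewrite in_itv/= => /andP[sc ct] Xc.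
have sc' : s < c.
  rewrite lt_neqAle sc andbT; apply/eqP => sc'; move: Xc.
  by rewrite -sc' subrr normr0 => /eqP; rewrite lt_eqF.
by have := noexit c (conj sc' Xc); rewrite ltNge ct.
Qed.

(** The exit times form a closed set, because the gap vanishes at [s] and [h] is
positive; so their infimum is one of them. *)
Lemma first_exit_attained : exits !=set0 -> exits (inf exits).
Proof.
move=> exits0; set a := inf exits.
have lbs : lbound exits s by move=> u [su _]; exact: ltW.
have hlb : has_lbound exits by exists s.
have sa : s <= a by exact: lb_le_inf.
have ga : `|X a - X s| = h.
  apply/eqP; apply/negP => /negP gah.
  have : \forall t \near a, `|X t - X s| - h != 0.
    have cg : `|X t - X s| - h @[t --> a] --> `|X a - X s| - h.
      by apply: cvgB; [exact: continuous_gap|exact: cvg_cst].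
    by apply: (cvgr_neq0 _ cg); rewrite subr_eq0.
  case/nbhs_ballP => e /= e0 he.
  have [u eu ua] := inf_adherent e0 (conj exits0 hlb).
  have au : a <= u by exact: ge_inf.
  have := he u; rewrite /ball /= ltr_distlC => /(_ _)/eqP; apply.
    by apply/andP; split; [lra|exact: ua].
  by case: eu => _ ->; rewrite subrr.
split => //; rewrite lt_neqAle sa andbT; apply/eqP => sa'; move: ga.
by rewrite -sa' subrr normr0 => /eqP; rewrite lt_eqF.
Qed.

End first_exit.

Section embedded_walk.
Variables (R : realType) (k : nat) (w : path_space R).
Local Notation X := (brownian w).
Local Notation h := (mesh R k).
Local Notation hit := (hit k w).
Local Arguments Defs.hit : simpl never.
Local Notation tau n := (fine (hit n)).
Local Notation eta := (eta k w).

Lemma mesh_gt0 : 0 < h. Proof. by rewrite /mesh invr_gt0 exprn_gt0. Qed.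

Lemma hit_succ n : hit n.+1 = ereal_inf [set t%:E | t in [set t : R |
  (hit n < t%:E)%E /\ `|X t - X (tau n)| = h]].
Proof. by []. Qed.

Lemma hit_ge0 n : (0 <= hit n)%E.
Proof.
elim: n => [//|n IH]; rewrite hit_succ; apply: le_ereal_inf_tmp => _ [t [nt _] <-].
exact: le_trans IH (ltW nt).
Qed.

Lemma hit_fineK n : (hit n < +oo)%E -> hit n = (tau n)%:E.
Proof. by move=> hn; rewrite fineK// ge0_fin_numE// hit_ge0. Qed.

Lemma hitS n : (hit n.+1 < +oo)%E ->
  [/\ (hit n < +oo)%E, tau n < tau n.+1 & `|X (tau n.+1) - X (tau n)| = h].
Proof.
move=> hn1.
have hn : (hit n < +oo)%E.
  rewrite ltNge leye_eq; apply/negP => /eqP hn; move: hn1; rewrite hit_succ.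
  rewrite hn (_ : [set _ | _ in _] = set0) ?ereal_inf0 ?ltxx//.
  by rewrite predeqE => x; split => // -[t []]; rewrite ltNge leey.
pose exits := [set t : R | tau n < t /\ `|X t - X (tau n)| = h].
have hE : hit n.+1 = ereal_inf [set t%:E | t in exits].
  rewrite hit_succ; congr (ereal_inf [set _%:E | _ in _]).
  by rewrite predeqE => t; rewrite /= hit_fineK// lte_fin.
have exits0 : exits !=set0.
  apply/set0P/negP => /eqP e0; move: hn1.
  by rewrite hE e0 image_set0 ereal_inf0 ltxx.
have := first_exit_attained (brownian_continuous (w := w)) mesh_gt0 exits0.
have tE : tau n.+1 = inf exits.
  by rewrite hE ereal_inf_EFin//; exists (tau n) => t [/ltW].
by rewrite -tE => -[h1 h2]; split.
Qed.

Lemma hit_before n t : (hit n < +oo)%E -> tau n <= t -> (t%:E < hit n.+1)%E ->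
  `|X t - X (tau n)| < h.
Proof.
move=> hn nt tn1; apply: (before_exit (brownian_continuous (w := w)) mesh_gt0 nt).
move=> u eu; rewrite -lte_fin; apply: lt_le_trans tn1 _.
rewrite hit_succ; apply: ereal_inf_lbound; exists u => //.
by rewrite /= hit_fineK// lte_fin.
Qed.

Lemma hit_lt_le n p : (p <= n)%N -> (hit n < +oo)%E -> (hit p < +oo)%E /\ tau p <= tau n.
Proof.
elim: n => [|n IH]; first by rewrite leqn0 => /eqP ->.
rewrite leq_eqVlt => /orP[/eqP ->//|]; rewrite ltnS => pn /hitS[hn nn1 _].
by have [hp tp] := IH pn hn; split => //; exact: le_trans tp (ltW nn1).
Qed.

Lemma hit_gt n p : (n < p)%N -> (hit n < +oo)%E -> (hit n < hit p)%E.
Proof.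
move=> np hn; have [hp|] := ltP (hit p) +oo%E; last by rewrite leye_eq => /eqP ->.
case: p np hp => // p; rewrite ltnS => np hp.
have [hp' tp _] := hitS hp; have [_ tnp] := hit_lt_le np hp'.
by rewrite (hit_fineK hn) (hit_fineK hp) lte_fin (le_lt_trans tnp).
Qed.

Hypothesis w0 : X 0 = 0.

Lemma eta_increment n : (hit n.+1 < +oo)%E ->
  h * eta n.+1 = X (tau n.+1) - X (tau n).
Proof.
move=> hn1; have [hn _ /eqP] := hitS hn1; rewrite /Defs.eta hn1 /=.
set d := _ - _; have h0 := mesh_gt0.
rewrite eqr_norml => /andP[/orP[/eqP ->|/eqP ->] _].
  by rewrite eqxx mulr1.
by rewrite ifN ?eqxx ?mulrN1//; apply/eqP; lra.
Qed.

(** At a hitting time the series defining the embedded walk is a finite telescoping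
sum of increments of the path. *)
Lemma walk_hit n : (hit n < +oo)%E -> walk k w (tau n) = X (tau n).
Proof.
move=> hn; rewrite /walk.
pose F p := h * eta p * \1_[set s : R | (hit p <= s%:E)%E] (tau n).
have F0 p : (n < p)%N -> F p = 0.
  move=> np; rewrite /F indicE memNset ?mulr0//= -hit_fineK//.
  by apply/negP; rewrite -ltNge; exact: hit_gt.
have FE p : (p < n)%N -> F p.+1 = X (tau p.+1) - X (tau p).
  move=> pn; have [hp tp] := hit_lt_le pn hn.
  by rewrite /F indicE mem_set ?mulr1 ?eta_increment//= hit_fineK// lee_fin.
have Sn : \sum_(1 <= p < n.+1) F p = X (tau n).
  rewrite big_add1 /= big_nat.
  under eq_bigr => p /andP[_ pn] do rewrite FE//.
  by rewrite -big_nat telescope_sumr//= w0 subr0.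
apply: lim_near_cst => //; exists n.+1 => // N /= nN.
rewrite (@big_cat_nat _ _ _ n.+1)//= Sn.
by rewrite big_nat big1 ?addr0// => p /andP[np _]; exact: F0.
Qed.

(** The lattice point occupied at the [n]-th hitting time, as an integer: the
quotient is already an integer there, see [siteE]. *)
Definition site (n : nat) : int := Num.floor (X (tau n) / h).

Lemma site_step n : (hit n.+1 < +oo)%E -> X (tau n) = (site n)%:~R * h ->
  (site n.+1 = site n + 1 \/ site n.+1 = site n - 1) /\
  X (tau n.+1) = (site n.+1)%:~R * h.
Proof.
move=> hn1 Xn; have [hn _ /eqP] := hitS hn1; have h0 := mesh_gt0.
rewrite eqr_norml => /andP[/orP[] /eqP Xd _].
  have Xn1 : X (tau n.+1) = (site n + 1)%:~R * h.
    by rewrite rmorphD rmorph1 mulrDl -Xn mul1r; lra.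
  have -> : site n.+1 = site n + 1.
    by rewrite {1}/site Xn1 mulfK ?gt_eqF// intrKfloor.
  by split; [left|].
have Xn1 : X (tau n.+1) = (site n - 1)%:~R * h.
  by rewrite rmorphB rmorph1 mulrBl -Xn mul1r; lra.
have -> : site n.+1 = site n - 1.
  by rewrite {1}/site Xn1 mulfK ?gt_eqF// intrKfloor.
by split; [right|].
Qed.

Lemma site0 : site 0 = 0. Proof. by rewrite /site /= w0 mul0r floor0. Qed.

Lemma siteE n : (hit n < +oo)%E -> X (tau n) = (site n)%:~R * h.
Proof.
elim: n => [_|n IH hn1]; first by rewrite site0 /= w0 mul0r.
have [hn _ _] := hitS hn1.
by have [] := site_step hn1 (IH hn).
Qed.

Lemma siteS n : (hit n.+1 < +oo)%E -> site n.+1 = site n + 1 \/ site n.+1 = site n - 1.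
Proof.
move=> hn1; have [hn _ _] := hitS hn1.
by have [] := site_step hn1 (siteE hn).
Qed.

Lemma nsteps_hit t : 0 <= t -> (hit (nsteps k w t) <= t%:E)%E.
Proof.
move=> t0; rewrite /nsteps; case: xgetP => [n _ []//|_].
by rewrite /= lee_fin.
Qed.

(** Counts upcrossings on the integer-valued nearest neighbour path [site], so that
the rest of the combinatorics is about integers. *)
Lemma upcrossingsE (j : int) t : 0 <= t ->
  upcrossings k w j t =
  (\sum_(i < nsteps k w t) ((site i == j - 1)%R && (site i.+1 == j)))%N.
Proof.
move=> t0; rewrite /upcrossings -sum1_card big_mkcond; apply: eq_bigr => i _.
have hn : (hit (nsteps k w t) < +oo)%E by rewrite (le_lt_trans (nsteps_hit t0)) ?ltry.
have [hi _] := hit_lt_le (ltnW (ltn_ord i)) hn.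
have [hi1 _] := hit_lt_le (ltn_ord i) hn.
have hm : h != 0 by rewrite gt_eqF// mesh_gt0.
rewrite inE/= !walk_hit// !siteE//.
by rewrite !(inj_eq (mulIf hm)) !eqr_int; case: ifP.
Qed.

End embedded_walk.

(** * Discrete Tanaka formula *)

Definition posz (z : int) : int := Num.max z 0.

(** The positive part of [S - a] moves by the step of [S] when [S > a], by one at
an upcrossing of the edge from [a], and otherwise not at all. *)
Lemma discrete_tanaka (S : nat -> int) n (a : int) :
  (forall i, (i < n)%N -> S i.+1 = S i + 1 \/ S i.+1 = S i - 1) ->
  ((\sum_(i < n) ((S i == a) && (S i.+1 == a + 1)%R))%N : int) =
  posz (S n - a) - posz (S 0%N - a) - \sum_(i < n) ((a < S i)%R : nat)%:R * (S i.+1 - S i).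
Proof.
elim: n => [|n IH] step; first by rewrite !big_ord0 subrr subr0.
rewrite !big_ord_recr/= PoszD IH; last by move=> i ni; apply: step; exact: ltnW.
have := step n (ltnSn n); rewrite /posz.
move: (S n) (S n.+1) (\sum_(i < n) _) (S 0%N) => x y z u.
case=> ->.
  by case: eqP => [|?]; case: eqP => [|?]; case: ltP => ?; rewrite /= /Num.max; repeat case: ifPn => ? ; lia.
by case: eqP => [|?]; case: eqP => [|?]; case: ltP => ?; rewrite /= /Num.max; repeat case: ifPn => ?; lia.
Qed.

(** The boundary terms of the two formulas differ by an increment of
[s |-> posz (s - b) - posz (s - a)], which is 1-Lipschitz with oscillation
[b - a]; its square is at most the product of both bounds.  This geometric mean
gives the boundary term the same scaling as the martingale term. *)
Lemma discrete_tanaka_diff (S : nat -> int) n (a b : int) :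
  S 0%N = 0 -> a <= b ->
  (forall i, (i < n)%N -> S i.+1 = S i + 1 \/ S i.+1 = S i - 1) ->
  exists2 g : int, `|g| ^+ 2 <= (b - a) * `|S n| &
  ((\sum_(i < n) ((S i == b) && (S i.+1 == b + 1)%R))%N : int) -
  ((\sum_(i < n) ((S i == a) && (S i.+1 == a + 1)%R))%N : int) =
  g + \sum_(i < n) ((a < S i <= b)%R : nat)%:R * (S i.+1 - S i).
Proof.
move=> S0 ab step; rewrite (discrete_tanaka b step) (discrete_tanaka a step) S0 !sub0r.
exists (posz (S n - b) - posz (- b) - (posz (S n - a) - posz (- a))).
  set g := _ - _; move: (S n) @g => s g.
  have g1 : `|g| <= b - a.
    by rewrite /g /posz /Num.max; repeat case: ifPn => ?; lia.
  have g2 : `|g| <= `|s|.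
    by rewrite /g /posz /Num.max; repeat case: ifPn => ?; lia.
  by rewrite expr2 ler_pM.
have -> : \sum_(i < n) ((a < S i <= b)%R : nat)%:R * (S i.+1 - S i) =
   \sum_(i < n) ((a < S i)%R : nat)%:R * (S i.+1 - S i) -
   \sum_(i < n) ((b < S i)%R : nat)%:R * (S i.+1 - S i).
  rewrite -sumrB; apply: eq_bigr => i _; rewrite -mulrBl; congr (_ * _).
  by case: (ltP a (S i)); case: (leP (S i) b) => //=; lia.
by set x := \sum_(i < n) _; set y := \sum_(i < n) _; ring.
Qed.

Lemma cvg_sum_ord (R : realType) n (f : nat -> nat -> R) (l : nat -> R) :
  (forall i, f N i @[N --> \oo] --> l i) ->
  \sum_(i < n) f N i @[N --> \oo] --> \sum_(i < n) l i.
Proof.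
move=> fl; elim: n => [|n IH].
  by rewrite big_ord0; under eq_fun do rewrite big_ord0; exact: cvg_cst.
by rewrite big_ord_recr; under eq_fun do rewrite big_ord_recr; exact: cvgD.
Qed.

(** * Discrete stochastic integrals of the embedded walk *)

Section site_process.
Variables (R : realType) (T : R) (T0 : 0 < T) (k : nat) (w : path_space R).
Local Notation W := (path_space R).
Local Notation X := (brownian w).
Local Notation h := (mesh R k).
Local Notation hit := (hit k w).
Local Arguments Defs.hit : simpl never.
Local Notation tau n := (fine (hit n)).
Local Notation grid := (grid T).
Local Notation site := (site k w).

(** For a path that starts at 0: in units of the mesh, the last lattice point
visited by the time [grid N r] is above [a] and at most [b]. *)
Definition between_sites (N : nat) (a b : int) (r : nat) : set W :=
  last_below T (b%:~R * h) ((b + 1)%:~R * h) (grid N r) `\`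
  last_below T (a%:~R * h) ((a + 1)%:~R * h) (grid N r).

Lemma adapted_between_sites N a b : adapted T N (between_sites N a b).
Proof. by move=> r; apply: measurableD; exact: measurable_last_below. Qed.

(** The first event forces the path below [(b + 1) * h] at the present time, and a
path below [a * h] at present would belong to the second.  Hence the clock of
[between_sites] is at most an occupation time, for every path. *)
Lemma between_sites_strip N a b r :
  between_sites N a b r `<=` in_strip T N (a%:~R * h) ((b + 1)%:~R * h) r.
Proof.
move=> w' [[p hp] na]; rewrite /in_strip /= in_itv/=; apply/andP; split.
  rewrite leNgt; apply/negP => wa; apply: na.
  (* With this slack the bound [(a + 1) * h - 2 ^- k] is [a * h], and the present
     time is a witness. *)
  exists (2 ^ k).-1 => e; exists N, r; split => //.
    by rewrite (le_trans (ltW wa))// lerDl.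
  move=> M' j; rewrite andbC -eq_le => /eqP ->.
  rewrite (le_trans (ltW wa))// prednK ?expn_gt0// natrX.
  by rewrite intrD mulrDl mul1r addrK.
have [M [i [Mr _ hM]]] := hp 0%N.
have := hM N r; rewrite Mr lexx => /(_ isT) /le_trans; apply.
by rewrite gerBl.
Qed.

(** The first grid point at or after [s]. *)
Definition grid_index (N : nat) (s : R) : nat := `|Num.ceil (s * 2 ^+ N / T)|%N.

Lemma grid_index_gt N s r : 0 <= s -> (r < grid_index N s)%N = (grid N r < s).
Proof.
move=> s0; have c0 : 0 <= s * 2 ^+ N / T by rewrite divr_ge0 ?mulr_ge0 ?exprn_ge0 ?(ltW T0).
rewrite /grid_index -ltz_nat gez0_abs ?ceil_ge0 ?(lt_le_trans _ c0) ?ltrN10//.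
rewrite ceil_gt_int -pmulrn /grid ltr_pdivlMr// ltr_pdivrMr ?exprn_gt0//.
Qed.

Lemma grid_index_le N s : 0 <= s -> s <= T -> (grid_index N s <= 2 ^ N)%N.
Proof. by move=> s0 sT; rewrite leqNgt grid_index_gt// gridT -leNgt. Qed.

Lemma grid_index_ge N s : 0 <= s -> s <= grid N (grid_index N s).
Proof. by move=> s0; rewrite leNgt -grid_index_gt// ltnn. Qed.

Lemma grid_index_dist N s : 0 <= s -> grid N (grid_index N s) < s + T / 2 ^+ N.
Proof.
move=> s0; case E : (grid_index N s) => [|r].
  by rewrite grid0 ltr_wpDl// divr_gt0// exprn_gt0.
by rewrite gridS ltrD2r -grid_index_gt// E.
Qed.

Lemma grid_index0 N : grid_index N 0 = 0%N.
Proof. by rewrite /grid_index !mul0r ceil0. Qed.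

Lemma cvg_mesh_size : T / 2 ^+ N @[N --> \oo] --> (0 : R).
Proof.
rewrite -[X in _ --> X](mulr0 T); apply: cvgM; first exact: cvg_cst.
have := @cvg_geometric R 1 2^-1 _.
rewrite /geometric /= => /(_ _).
under eq_fun do rewrite mul1r exprVn; apply.
by rewrite ger0_norm// invf_lt1// ltr1n.
Qed.

Lemma cvg_grid_index s : 0 <= s -> grid N (grid_index N s) @[N --> \oo] --> s.
Proof.
move=> s0; apply: (@squeeze_cvgr _ _ _ _ (cst s) (fun N => s + T / 2 ^+ N)).
- by near=> N; rewrite grid_index_ge//= ltW// grid_index_dist.
- exact: cvg_cst.
- rewrite -[X in _ --> X]addr0; apply: cvgD; first exact: cvg_cst.
  exact: cvg_mesh_size.
Unshelve. all: by end_near. Qed.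

(** Dyadic times approximate from the right; [s] itself is used when it is the
right end point. *)
Lemma dyadic_near (s : R) N r e : 0 <= s -> s <= grid N r -> 0 < e ->
  exists M i, s <= grid M i <= grid N r /\ `|X (grid M i) - X s| < e.
Proof.
move=> s0; rewrite le_eqVlt => /orP[/eqP -> e0|sr e0].
  by exists N, r; rewrite lexx subrr normr0.
have cX : X (grid M (grid_index M s)) @[M --> \oo] --> X s.
  by apply: continuous_cvg; [exact: brownian_continuous|exact: cvg_grid_index].
have near1 : \forall M \near \oo, `|X (grid M (grid_index M s)) - X s| < e.
  by move/cvgrPdistC_lt : cX; exact.
have near2 : \forall M \near \oo, grid M (grid_index M s) < grid N r.
  by apply: cvgr_lt sr; exact: cvg_grid_index.
near \oo => M; exists M, (grid_index M s); split; last by near: M.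
by rewrite grid_index_ge//= ltW//; near: M.
Unshelve. all: by end_near. Qed.

Hypothesis w0 : X 0 = 0.

Lemma displacementE t : displacement w t = X t.
Proof. by rewrite /displacement w0 subr0. Qed.

Lemma small_inv (e : R) : 0 < e -> exists p : nat, p.+1%:R^-1 < e.
Proof.
move=> e0; exists (Num.truncn e^-1).
by rewrite invf_plt ?posrE ?ltr0n// truncnS_gt.
Qed.

(** Since the last hitting time the path has stayed within one mesh of the current
site.  If that site exceeds [c], the path has stayed away from [c * mesh] since
then, so a witness of the event must precede the hitting time, at which the path
is too high.  If not, the maximum of the path since the hitting time is below
[(c + 1) * mesh], which provides the slack, and dyadic times just after the
hitting time are witnesses. *)
Lemma last_belowP n (c : int) N r : (hit n < +oo)%E -> tau n <= grid N r ->
  ((grid N r)%:E < hit n.+1)%E ->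
  last_below T (c%:~R * h) ((c + 1)%:~R * h) (grid N r) w <-> site n <= c.
Proof.
move=> hn nr rn1; set s := grid N r; have h0 := mesh_gt0 R k.
have Xn := siteE w0 hn.
have tn0 : 0 <= tau n by rewrite -lee_fin -hit_fineK// hit_ge0.
have cts : {within `[tau n, s], continuous X}.
  by apply: continuous_subspaceT => ?; exact: brownian_continuous.
have band t : tau n <= t <= s -> `|X t - X (tau n)| < h.
  move=> /andP[nt ts]; apply: hit_before => //.
  by apply: le_lt_trans rn1; rewrite lee_fin.
split => [[p hp]|sc].
- rewrite leNgt; apply/negP => cs.
  have Xc : (c + 1)%:~R * h <= X (tau n).
    by rewrite Xn ler_pM2r// ler_int; lia.
  have [m] := EVT_min nr cts; rewrite in_itv/= => mI minm.
  have Xm : c%:~R * h < X m.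
    have := band m mI; rewrite ltr_norml intrD mulrDl mul1r in Xc *; lra.
  have [|e he] := @small_inv (X m - c%:~R * h); first by rewrite subr_gt0.
  have [M [i [Ms]]] := hp e.
  rewrite displacementE => XM hM.
  have Mn : grid M i < tau n.
    rewrite ltNge; apply/negP => nM.
    have XmM : X m <= X (grid M i) by apply: minm; rewrite in_itv/= nM Ms.
    by have := le_trans XmM XM; rewrite leNgt -ltrBrDl he.
  have p0 : 0 < p.+1%:R^-1 :> R by rewrite invr_gt0 ltr0n.
  have [M' [j [/andP[nM' M's] dM']]] := dyadic_near tn0 nr p0.
  have := hM M' j; rewrite (le_trans (ltW Mn) nM') M's => /(_ isT).
  by rewrite displacementE; move: dM'; rewrite ltr_norml; move: (p.+1%:R^-1) => y; lra.
- have Xc : X (tau n) <= c%:~R * h by rewrite Xn ler_pM2r// ler_int.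
  have [m] := EVT_max nr cts; rewrite in_itv/= => mI maxm.
  have Xm : X m < (c + 1)%:~R * h.
    have := band m mI; rewrite ltr_norml intrD mulrDl mul1r; lra.
  have [|p hp] := @small_inv ((c + 1)%:~R * h - X m); first by rewrite subr_gt0.
  exists p => e.
  have e0 : 0 < e.+1%:R^-1 :> R by rewrite invr_gt0 ltr0n.
  have [M [i [/andP[nM Ms] dM]]] := dyadic_near tn0 nr e0.
  exists M, i; split => //.
    by rewrite displacementE; move: dM; rewrite ltr_norml; move: (e.+1%:R^-1) => y; lra.
  move=> M' j /andP[MM' M's]; rewrite displacementE.
  have := maxm (grid M' j); rewrite in_itv/= (le_trans nM MM') M's => /(_ isT).
  by move: hp; move: (p.+1%:R^-1) => y; lra.
Qed.

Lemma between_sitesP n (a b : int) N r : (hit n < +oo)%E -> tau n <= grid N r ->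
  ((grid N r)%:E < hit n.+1)%E ->
  \1_(between_sites N a b r) w = ((a < site n <= b)%R : nat)%:R :> R.
Proof.
move=> hn nr rn1; rewrite indicE; congr (nat_of_bool _)%:R.
apply/idP/andP => [|[an nb]]; rewrite inE.
  case=> /(last_belowP _ hn nr rn1) nb na; split => //.
  by rewrite ltNge; apply/negP => /(last_belowP _ hn nr rn1).
split; first exact/(last_belowP _ hn nr rn1).
by move=> /(last_belowP _ hn nr rn1); rewrite leNgt an.
Qed.

(** Between the grid points that follow two consecutive hitting times the integrand
is constant, by [between_sitesP], and the increments telescope. *)
Lemma transform_hit N (a b : int) n : (hit n < +oo)%E ->
  transform T N (between_sites N a b) (grid_index N (tau n)) w =
  \sum_(i < n) ((a < site i <= b)%R : nat)%:R *
    (X (grid N (grid_index N (tau i.+1))) - X (grid N (grid_index N (tau i)))).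
Proof.
elim: n => [_|n IH hn1]; first by rewrite big_ord0 /= grid_index0 /transform big_ord0.
have [hn nn1 _] := hitS hn1.
have tn0 : 0 <= tau n by rewrite -lee_fin -hit_fineK// hit_ge0.
have tn10 : 0 <= tau n.+1 := le_trans tn0 (ltW nn1).
have le_idx : (grid_index N (tau n) <= grid_index N (tau n.+1))%N.
  rewrite leqNgt grid_index_gt// -leNgt (le_trans (ltW nn1))//.
  exact: grid_index_ge.
rewrite big_ord_recr/= -IH// /transform.
rewrite -!(big_mkord xpredT (fun i => \1_(between_sites N a b i) w *
  (displacement w (grid N i.+1) - displacement w (grid N i)))).
rewrite (big_cat_nat (leq0n _) le_idx)//=; congr (_ + _).
rewrite big_nat.
under eq_bigr => r /andP[nr rn1].
  rewrite (@between_sitesP n)//; last 2 first.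
  - by rewrite leNgt -grid_index_gt// -leqNgt.
  - by rewrite (hit_fineK hn1) lte_fin -grid_index_gt.
  rewrite !displacementE; over.
by rewrite -big_nat -mulr_sumr telescope_sumr.
Qed.

Lemma cvg_transform_hit (a b : int) n : (hit n < +oo)%E ->
  transform T N (between_sites N a b) (grid_index N (tau n)) w @[N --> \oo] -->
  \sum_(i < n) ((a < site i <= b)%R : nat)%:R * (X (tau i.+1) - X (tau i)).
Proof.
move=> hn; under eq_fun do rewrite transform_hit//.
have cXt p : X (grid N (grid_index N (tau p))) @[N --> \oo] --> X (tau p).
  apply: continuous_cvg; first exact: brownian_continuous.
  by apply: cvg_grid_index; rewrite fine_ge0// hit_ge0.
apply: (@cvg_sum_ord R n (fun N i => ((a < site i <= b)%R : nat)%:R *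
   (X (grid N (grid_index N (tau i.+1))) - X (grid N (grid_index N (tau i)))))
  (fun i => ((a < site i <= b)%R : nat)%:R * (X (tau i.+1) - X (tau i)))) => i.
by apply: cvgM; [exact: cvg_cst|exact: cvgB].
Qed.

Lemma transform_setT N r : transform T N (fun=> setT) r w = X (grid N r).
Proof.
rewrite /transform; under eq_bigr do rewrite indicT mul1r !displacementE.
by rewrite -(big_mkord xpredT (fun r => X (grid N r.+1) - X (grid N r)))
  telescope_sumr// grid0 w0 subr0.
Qed.

(** Tanaka's formula for the embedded walk, multiplied by the mesh. *)
Lemma upcrossings_increment t (a b : int) : 0 <= t -> a <= b ->
  let n := nsteps k w t in
  `|2 * h * (upcrossings k w (b + 1) t)%:R - 2 * h * (upcrossings k w (a + 1) t)%:R| <=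
  2 * Num.sqrt ((b - a)%:~R * h * `|X (tau n)|) +
  2 * `|\sum_(i < n) ((a < site i <= b)%R : nat)%:R * (X (tau i.+1) - X (tau i))|.
Proof.
move=> t0 ab /=; set n := nsteps k w t; have h0 := mesh_gt0 R k.
have hn : (hit n < +oo)%E by rewrite (le_lt_trans (nsteps_hit k w t0)) ?ltry.
have hi i : (i <= n)%N -> (hit i < +oo)%E by move=> /hit_lt_le /(_ hn)[].
have step i : (i < n)%N -> site i.+1 = site i + 1 \/ site i.+1 = site i - 1.
  by move=> ni; apply: siteS => //; exact: hi.
have [g g2 gE] := discrete_tanaka_diff (site0 k w0) ab step.
rewrite !upcrossingsE// !addrK -mulrBr -[2 * h * _]mulrA.
set ub := (\sum_(i < n) _)%N in gE *; set ua := (\sum_(i < n) _)%N in gE *.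
have -> : h * (ub%:R - ua%:R) =
   h * g%:~R + \sum_(i < n) ((a < site i <= b)%R : nat)%:R * (X (tau i.+1) - X (tau i)).
  rewrite (pmulrn 1 ub) (pmulrn 1 ua) -intrB gE intrD mulrDr; congr (_ + _).
  rewrite rmorph_sum mulr_sumr; apply: eq_bigr => i _.
  have i1 : (hit i.+1 < +oo)%E by apply: hi.
  have i0 : (hit i < +oo)%E by apply: hi; exact: ltnW.
  rewrite rmorphM rmorphB /= mulrCA (siteE w0 i1) (siteE w0 i0) -mulrBl [h * _]mulrC.
  by rewrite rmorph_nat.
rewrite normrM ger0_norm// -mulrDr ler_wpM2l//.
apply: le_trans (ler_normD _ _) _; rewrite lerD2r.
rewrite -[leLHS]ger0_norm// -sqrtr_sqr ler_wsqrtr//.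
rewrite (siteE w0 hn) [X in _ <= _ * X]normrM [`|h|]gtr0_norm// real_normK ?num_real// exprMn.
have gle : g%:~R ^+ 2 <= (b - a)%:~R * `|(site n)%:~R| :> R.
  rewrite -[leLHS]real_normK ?num_real// -!intr_norm -rmorphXn -rmorphM /=.
  by rewrite ler_int.
rewrite [leRHS]mulrACA -expr2 [leLHS]mulrC; apply: ler_wpM2r => //.
by rewrite sqr_ge0.
Qed.

(** The sum over hitting times is the limit of transforms stopped at grid points,
which are dominated by running maxima over the whole grid; these no longer
depend on [t], so the bound is uniform in [t].  The approximations [V] are kept
in the statement because the running maxima need not converge. *)
Lemma upcrossings_increment_lim t (a b : int) : 0 <= t <= T -> a <= b ->
  exists V : nat -> R, exists v, [/\ forall N, 0 <= V N, V @ \oo --> v,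
   `|2 * h * (upcrossings k w (b + 1) t)%:R - 2 * h * (upcrossings k w (a + 1) t)%:R| <= v &
   forall N, V N <=
     2 * Num.sqrt ((b - a)%:~R * h * running_max T N (fun=> setT) (2 ^ N) w) +
     2 * running_max T N (between_sites N a b) (2 ^ N) w].
Proof.
move=> /andP[t0 tT] ab; set n := nsteps k w t; have h0 := mesh_gt0 R k.
have hnt : (hit n <= t%:E)%E by exact: (nsteps_hit k w t0).
have hn : (hit n < +oo)%E by rewrite (le_lt_trans hnt) ?ltry.
have tn0 : 0 <= tau n by rewrite fine_ge0// hit_ge0.
have tnT : tau n <= T.
  by rewrite (le_trans _ tT)// -lee_fin -hit_fineK.
have idx N : (grid_index N (tau n) <= 2 ^ N)%N by exact: grid_index_le.
exists (fun N => 2 * Num.sqrt ((b - a)%:~R * h * `|X (grid N (grid_index N (tau n)))|) +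
  2 * `|transform T N (between_sites N a b) (grid_index N (tau n)) w|).
eexists; split; last 1 first.
- move=> N; apply: lerD; rewrite ler_wpM2l//; last exact: le_running_max.
  rewrite ler_wsqrtr// ler_wpM2l//.
    by rewrite mulr_ge0 ?(ltW h0)// ler0z subr_ge0.
  by rewrite -transform_setT; exact: le_running_max.
- by move=> N; rewrite addr_ge0// mulr_ge0// sqrtr_ge0.
- apply: cvgD; apply: cvgM; [exact: cvg_cst| |exact: cvg_cst|]; last first.
    by apply: cvg_norm; exact: cvg_transform_hit.
  apply: continuous_cvg; first exact: sqrt_continuous.
  apply: cvgM; first exact: cvg_cst.
  apply: cvg_norm; apply: continuous_cvg; first exact: brownian_continuous.
  exact: cvg_grid_index.
- exact: upcrossings_increment.
Qed.

End site_process.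

(** * Moments of running maxima *)

Section moments.
Variables (R : realType) (p : R).

Lemma clock_le (T : R) N (H K : nat -> set (path_space R)) n w : 0 < T ->
  (forall i, H i `<=` K i) -> clock T N H n w <= clock T N K n w.
Proof.
move=> T0 HK; apply: ler_sum => i _; apply: ler_wpM2r; first exact/ltW/mesh_size_gt0.
rewrite !indicE ler_nat; case: (boolP (w \in H i)) => //; rewrite inE => /HK Kw.
by rewrite mem_set.
Qed.

(** The time spent in a strip of width [b - a] before [T] is of order
[(b - a) * sqrt T], hence the transform is of the order of its square root. *)
Lemma strip_moment : 0 <= p -> exists2 C : R, 0 < C &
  forall (T : R) (P : probability (path_space R) R) N H (a b : R),
    0 < T -> wiener_measure P -> adapted T N H -> a < b ->
    (forall i, H i `<=` in_strip T N a b i) ->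
    T / 2 ^+ N <= (b - a) * Num.sqrt T ->
    (\int[P]_w ((running_max T N H (2 ^ N) w) `^ p)%:E <=
     (C * ((b - a) * Num.sqrt T) `^ (p / 2))%:E)%E.
Proof.
move=> p0; have [C C0 hC] := running_max_moment p0.
exists (C * 3 * 12 `^ (p / 2)) => [|T P N H a b T0 wP aH ab Hst dtl].
  by rewrite !mulr_gt0// powR_gt0.
set x := (b - a) * Num.sqrt T.
have x0 : 0 < x by rewrite mulr_gt0 ?subr_gt0// sqrtr_gt0.
have s0 : 0 < Num.sqrt (12 * x) by rewrite sqrtr_gt0 mulr_gt0.
(* This choice makes [2 * c ^+ 2 = (6 * x)^-1], while the expected occupation is at
   most [x + 2 * x]. *)
have := hC T P N H (2 ^ N)%N (Num.sqrt (12 * x))^-1 2 T0 wP aH.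
rewrite invr_gt0 s0 => /(_ isT (ler0n _ _)).
have cE : 2 * (Num.sqrt (12 * x))^-1 ^+ 2 = (6 * x)^-1.
  rewrite exprVn sqr_sqrtr; last by rewrite mulr_ge0// ltW.
  have -> : 12 * x = 2 * (6 * x) by ring.
  by rewrite invfM mulrA mulfV// mul1r.
rewrite cE invrK => h.
apply: le_trans (h _) _.
- apply: le_trans (exp_clock_le2 T0 wP (ltW ab) (mu := (6 * x)^-1) (N := N) _ _).
  + apply: ge0_le_integral => //=.
    * apply/measurable_EFinP; apply: measurableT_comp => //.
      apply: measurable_funM; first exact: measurable_cst.
      apply: (@measurable_fun_past _ T _ _ (grid T N (2 ^ N))).
      by apply: measurable_clock => // i iN; rewrite grid_le// ltnW.
    * apply/measurable_EFinP; apply: measurableT_comp => //.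
      apply: measurable_funM; first exact: measurable_cst.
      apply: (@measurable_fun_past _ T _ _ (grid T N (2 ^ N))).
      by apply: measurable_clock; [exact: adapted_in_strip|move=> i iN; rewrite grid_le// ltnW].
    * move=> w _; rewrite lee_fin ler_expR; apply: ler_wpM2l.
        by rewrite invr_ge0 mulr_ge0// ltW.
      exact: clock_le.
  + by rewrite invr_ge0 mulr_ge0// ltW.
  + rewrite /mesh_size -/x mulrC ler_pdivrMr; last by apply: mulr_gt0.
    by rewrite -mulrA -/x; move: dtl; rewrite -/x; lra.
- have x12 : 0 <= 12 * x by apply: mulr_ge0 => //; exact: ltW.
  rewrite lee_fin -(powR12_sqrt x12) -powRrM (powRM _ (ler0n _ 12) (ltW x0)).
  rewrite [2^-1 * p]mulrC [leLHS]mulrA.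
  by have -> : C * (1 + 2) = C * 3 by ring.
Qed.

(** Here the clock is [T] for every path. *)
Lemma displacement_moment : 0 <= p -> exists2 C : R, 0 < C &
  forall (T : R) (P : probability (path_space R) R) N,
    0 < T -> wiener_measure P ->
    (\int[P]_w ((running_max T N (fun=> setT) (2 ^ N) w) `^ p)%:E <=
     (C * T `^ (p / 2))%:E)%E.
Proof.
move=> p0; have [C C0 hC] := running_max_moment p0.
exists (C * (1 + expR 2)) => [|T P N T0 wP].
  by rewrite mulr_gt0// addr_gt0 ?expR_gt0.
have aT : adapted T N (fun=> setT) by [].
have := hC T P N (fun=> setT) (2 ^ N)%N (Num.sqrt T)^-1 (expR 2) T0 wP aT.
rewrite invr_gt0 sqrtr_gt0 T0 => /(_ isT (expR_ge0 _)).
rewrite invrK -powR12_sqrt ?(ltW T0)// -powRrM [2^-1 * p]mulrC; apply.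
under eq_integral.
  move=> w _; rewrite /clock.
  under eq_bigr do rewrite indicT mul1r.
  rewrite sumr_const card_ord -(mulr_natr (mesh_size T N)) /mesh_size natrX.
  rewrite divfK ?expf_neq0// powR12_sqrt ?(ltW T0)// exprVn sqr_sqrtr ?(ltW T0)//.
  rewrite divfK ?gt_eqF//.
  over.
by rewrite integral_cst//= probability_setT mule1.
Qed.

End moments.

(** * Chaining over dyadic blocks *)

Section chaining.
Variable R : realType.

(** An interval of integers is filled by dyadic blocks, at most two of each size:
remove an odd end point on either side and halve what is left. *)
Lemma dyadic_path_le (L : nat) (v : nat -> R) (rho : nat -> R) (x y : nat) :
  (x <= y)%N -> (y <= 2 ^ L)%N -> (forall n, 0 <= rho n) ->
  (forall n i, (n <= L)%N -> (x <= 2 ^ n * i)%N -> (2 ^ n * i.+1 <= y)%N ->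
     `|v (2 ^ n * i.+1)%N - v (2 ^ n * i)%N| <= rho n) ->
  `|v y - v x| <= 2 * \sum_(n < L.+1) rho n.
Proof.
elim: L v rho x y => [|L IH] v rho x y.
  rewrite expn0 => xy y1 rho0 hv; rewrite big_ord_recl big_ord0 addr0.
  have [->|xy'] := eqVneq x y.
    by rewrite subrr normr0 mulr_ge0.
  have {xy xy'} xy : (x < y)%N by rewrite ltn_neqAle xy'.
  have -> : y = 1%N by lia.
  have -> : x = 0%N by lia.
  have := hv 0%N 0%N; rewrite expn0 !mul1n => /(_ isT).
  move=> /(_ ltac:(lia) ltac:(lia)) h; apply: le_trans h _.
  by have := rho0 0%N; lra.
move=> xy yL rho0 hv.
have [->|xy'] := eqVneq x y.
  by rewrite subrr normr0 mulr_ge0// sumr_ge0.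
have {xy xy'} xy : (x < y)%N by rewrite ltn_neqAle xy'.
set x' := uphalf x; set y' := y./2.
have y'y : (2 * y' <= y)%N by rewrite /y'; lia.
have xx' : (x <= 2 * x')%N by rewrite /x'; lia.
have x'y' : (x' <= y')%N by rewrite /x' /y'; lia.
have := IH (fun i => v (2 * i)%N) (fun n => rho n.+1) x' y' x'y'.
move=> /(_ _ (fun n => rho0 _)) h.
have {}h : `|v (2 * y')%N - v (2 * x')%N| <= 2 * \sum_(n < L.+1) rho n.+1.
  apply: h; first by rewrite expnS in yL; rewrite /y'; lia.
  move=> n i nL xi iy; have := hv n.+1 i nL.
  rewrite expnS -!mulnA; apply.
    by apply: leq_trans xx' _; rewrite leq_mul2l.
  by apply: leq_trans y'y; rewrite leq_mul2l.
have hx : `|v (2 * x')%N - v x| <= rho 0%N.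
  have [xe|xo] := boolP (odd x); last first.
    have -> : (2 * x')%N = x by rewrite /x'; lia.
    by rewrite subrr normr0.
  have := hv 0%N x isT; rewrite expn0 !mul1n leqnn => /(_ isT xy).
  by have -> : (2 * x')%N = x.+1 by rewrite /x'; lia.
have hy : `|v y - v (2 * y')%N| <= rho 0%N.
  have [yo|ye] := boolP (odd y); last first.
    have -> : (2 * y')%N = y by rewrite /y'; lia.
    by rewrite subrr normr0.
  have yE : y = (2 * y').+1 by rewrite /y'; lia.
  have := hv 0%N (2 * y')%N isT; rewrite expn0 !mul1n -yE leqnn.
  by move=> /(_ ltac:(lia) isT).
rewrite big_ord_recl mulrDr.
have -> : v y - v x = (v y - v (2 * y')%N) + (v (2 * y')%N - v (2 * x')%N) + (v (2 * x')%N - v x).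
  by ring.
apply: le_trans (ler_normD _ _) _; apply: le_trans (lerD (ler_normD _ _) (lexx _)) _.
have -> : \sum_(i < L.+1) rho (lift ord0 i) = \sum_(n < L.+1) rho n.+1 by apply: eq_bigr.
by move: h; rewrite /=; lra.
Qed.

(** Restricting the sum to the dyadic blocks inside [x, y] makes it superadditive
over adjacent intervals, as chaining along a partition requires. *)
Definition dyadic_energy (L : nat) (v : nat -> R) (wt : nat -> R) (q : R) (x y : nat) : R :=
  \sum_(n < L.+1) wt n * \sum_(i < 2 ^ (L - n))
    ((x <= 2 ^ n * i)%N && (2 ^ n * i.+1 <= y)%N)%:R *
    `|v (2 ^ n * i.+1)%N - v (2 ^ n * i)%N| `^ q.

Variables (L : nat) (v : nat -> R) (wt : nat -> R) (q : R).
Hypotheses (q0 : 0 < q) (wt0 : forall n, 0 < wt n).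
Local Notation energy := (dyadic_energy L v wt q).

Lemma dyadic_energy_ge0 x y : 0 <= energy x y.
Proof.
apply: sumr_ge0 => n _; apply: mulr_ge0; first exact: ltW.
by apply: sumr_ge0 => i _; apply: mulr_ge0; [exact: ler0n|exact: powR_ge0].
Qed.

Lemma dyadic_energy_superadditive x y z : (x <= y)%N -> (y <= z)%N ->
  energy x y + energy y z <= energy x z.
Proof.
move=> xy yz; rewrite -big_split/=; apply: ler_sum => n _.
rewrite -mulrDr; apply: ler_wpM2l; first exact: ltW.
rewrite -big_split/=; apply: ler_sum => i _; rewrite -mulrDl.
apply: ler_wpM2r; first exact: powR_ge0.
rewrite -natrD ler_nat.
have : (2 ^ n * i < 2 ^ n * i.+1)%N by rewrite ltn_pmul2l ?expn_gt0.
move: (2 ^ n * i)%N (2 ^ n * i.+1)%N => c d cd.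
case: (leqP x c) => xc; case: (leqP d y) => dy; case: (leqP y c) => yc;
  case: (leqP d z) => dz //=; lia.
Qed.

(** Each increment over a block inside [x, y] is bounded by its share of the energy;
then sum along a dyadic path. *)
Lemma increment_le_energy x y : (x <= y)%N -> (y <= 2 ^ L)%N ->
  `|v y - v x| `^ q <=
  (2 * \sum_(n < L.+1) (wt n)^-1 `^ q^-1) `^ q * energy x y.
Proof.
move=> xy yL; set E := energy x y.
have E0 : 0 <= E by exact: dyadic_energy_ge0.
have iq : 0 <= q^-1 by rewrite invr_ge0 ltW.
have h : `|v y - v x| <= 2 * \sum_(n < L.+1) (E * (wt n)^-1) `^ q^-1.
  apply: (@dyadic_path_le L v (fun n => (E * (wt n)^-1) `^ q^-1) x y) => //.
    by move=> n; exact: powR_ge0.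
  move=> n i nL xi iy.
  have -> : `|v (2 ^ n * i.+1)%N - v (2 ^ n * i)%N| =
      (`|v (2 ^ n * i.+1)%N - v (2 ^ n * i)%N| `^ q) `^ q^-1.
    by rewrite -powRrM mulfV ?gt_eqF// powRr1.
  apply: ge0_ler_powR => //; rewrite ?nnegrE ?powR_ge0//.
    by rewrite mulr_ge0// invr_ge0 ltW.
  rewrite ler_pdivlMr// mulrC /E /dyadic_energy.
  have nL1 : (n < L.+1)%N by [].
  have iL : (i < 2 ^ (L - n))%N.
    rewrite -(ltn_pmul2l (expn_gt0 2 n)) -expnD subnKC//.
    apply: leq_trans (leq_trans _ iy) yL.
    by rewrite ltn_pmul2l ?expn_gt0.
  rewrite (bigD1 (Ordinal nL1))//= (bigD1 (Ordinal iL))//= xi iy mul1r.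
  rewrite mulrDr -addrA lerDl addr_ge0//.
    apply: mulr_ge0; first exact: ltW.
    by apply: sumr_ge0 => j _; apply: mulr_ge0; [exact: ler0n|exact: powR_ge0].
  apply: sumr_ge0 => j _; apply: mulr_ge0; first exact: ltW.
  by apply: sumr_ge0 => l _; apply: mulr_ge0; [exact: ler0n|exact: powR_ge0].
have {}h : `|v y - v x| <= E `^ q^-1 * (2 * \sum_(n < L.+1) (wt n)^-1 `^ q^-1).
  apply: le_trans h _; rewrite mulrCA ler_wpM2l// mulr_sumr.
  by apply: ler_sum => n _; rewrite powRM// invr_ge0 ltW.
apply: (@le_trans _ _ ((E `^ q^-1 * (2 * \sum_(n < L.+1) (wt n)^-1 `^ q^-1)) `^ q)).
  have q0' := ltW q0.
  have B0 : 0 <= E `^ q^-1 * (2 * \sum_(n < L.+1) (wt n)^-1 `^ q^-1).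
    apply: mulr_ge0; first exact: powR_ge0.
    by apply: mulr_ge0 => //; apply: sumr_ge0 => n _; exact: powR_ge0.
  by apply: ge0_ler_powR; rewrite ?nnegrE.
rewrite powRM ?powR_ge0//; last by rewrite mulr_ge0// sumr_ge0// => n _; exact: powR_ge0.
by rewrite -powRrM mulVf ?gt_eqF// powRr1// mulrC.
Qed.

(** The energy of an interval is superadditive, so the bound for one increment can be
summed over a partition without any loss. *)
Lemma chain_variation_le (x : nat -> nat) s :
  (forall l, (l < s)%N -> (x l <= x l.+1)%N) -> (x s <= 2 ^ L)%N ->
  \sum_(0 <= l < s) `|v (x l.+1) - v (x l)| `^ q <=
  (2 * \sum_(n < L.+1) (wt n)^-1 `^ q^-1) `^ q * energy 0 (2 ^ L).
Proof.
move=> xS xL; set K := _ `^ q.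
have K0 : 0 <= K by exact: powR_ge0.
have mono : forall l l', (l <= l')%N -> (l' <= s)%N -> (x l <= x l')%N.
  move=> l; elim=> [|l' IH]; first by rewrite leqn0 => /eqP ->.
  rewrite leq_eqVlt => /orP[/eqP->//|]; rewrite ltnS => ll' l's.
  by apply: leq_trans (IH ll' (ltnW l's)) (xS _ l's).
have h : forall l, (l <= s)%N ->
    \sum_(0 <= l < l) `|v (x l.+1) - v (x l)| `^ q <= K * energy (x 0) (x l).
  elim=> [_|l IH ls]; first by rewrite big_geq// mulr_ge0// dyadic_energy_ge0.
  rewrite big_nat_recr//=.
  have := increment_le_energy (xS l ls) (leq_trans (mono l.+1 s ls (leqnn _)) xL).
  rewrite -/K => h; apply: le_trans (lerD (IH (ltnW ls)) h) _.
  rewrite -mulrDr ler_wpM2l//; apply: dyadic_energy_superadditive; last exact: xS.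
  by apply: mono => //; exact: ltnW.
apply: le_trans (h s (leqnn _)) _; rewrite ler_wpM2l//.
apply: ler_sum => n _; apply: ler_wpM2l; first exact: ltW.
apply: ler_sum => i _; apply: ler_wpM2r; first exact: powR_ge0.
rewrite ler_nat; case: andP => // -[_ h2] /=.
by rewrite (leq_trans h2).
Qed.

End chaining.

(** * Lower integrals and limits inferior *)

(** The integral of a nonnegative function is a supremum over the simple functions
below it, so it is monotone without measurability.  The supremum over [t] of the
variations enters the proof through this fact only. *)
Lemma ge0_le_lower_integral d (Om : measurableType d) (R : realType)
    (mu : {measure set Om -> \bar R}) (f g : Om -> \bar R) :
  (forall x, 0 <= f x)%E -> (forall x, f x <= g x)%E ->
  (\int[mu]_x f x <= \int[mu]_x g x)%E.
Proof.
move=> f0 fg.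
have g0 x : (0 <= g x)%E by exact: le_trans (f0 x) (fg x).
rewrite !ge0_integralTE//; apply: ge_ereal_sup => _ [u uf <-].
by apply: ereal_sup_ubound; exists u => // x; exact: le_trans (uf x) (fg x).
Qed.

Lemma cvg_le_limn_einf (R : realType) (u g : nat -> \bar R) (l : \bar R) :
  u @ \oo --> l -> (forall n, u n <= g n)%E -> (l <= limn_einf g)%E.
Proof.
move=> ul ug; have [<- _] := cvg_limn_einf_sup ul.
rewrite !limn_einf_lim; apply: lee_lim; [exact: is_cvg_einfs|exact: is_cvg_einfs|].
near=> n; apply: le_ereal_inf_tmp => _ [p /= np <-].
apply: le_trans (ug p); apply: ereal_inf_lbound; exists p => //.
Unshelve. all: by end_near. Qed.

Lemma limn_einf_le (R : realType) (g : nat -> \bar R) (B : \bar R) (N0 : nat) :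
  (forall n, (N0 <= n)%N -> g n <= B)%E -> (limn_einf g <= B)%E.
Proof.
move=> gB; rewrite limn_einf_lim; apply: lime_le; first exact: is_cvg_einfs.
near=> n; apply: le_trans (gB (maxn n N0) (leq_maxr _ _)).
by apply: ereal_inf_lbound; exists (maxn n N0) => //=; exact: leq_maxl.
Unshelve. all: by end_near. Qed.

Lemma cvg_powR (R : realType) (V : nat -> R) (v q : R) : 1 <= q ->
  (forall n, 0 <= V n) -> V @ \oo --> v -> V n `^ q @[n --> \oo] --> v `^ q.
Proof.
move=> q1 V0 Vv; have q0 : 0 < q by exact: lt_le_trans q1.
have v0 : 0 <= v.
  rewrite leNgt; apply/negP => v0.
  have : \forall n \near \oo, V n < 0 by exact: cvgr_lt v0.
  by case=> N _ /(_ N (leqnn N)); rewrite ltNge V0.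
move: v0; rewrite le_eqVlt => /orP[/eqP v0|v0].
  rewrite -v0 in Vv *; rewrite powR0 ?gt_eqF//.
  apply: (@squeeze_cvgr _ _ _ _ (cst 0) V) => //; last exact: cvg_cst.
  have V1 : \forall n \near \oo, V n < 1 by apply: (cvgr_lt _ Vv); exact: ltr01.
  near=> n; rewrite powR_ge0/= -(mulr_powRB1 (V0 n) q0) ler_piMr//.
  apply: (@le_trans _ _ (1 `^ (q - 1))); last by rewrite powR1.
  apply: ge0_ler_powR; rewrite ?nnegrE ?subr_ge0//; apply: ltW.
  by near: n.
have Vpos : \forall n \near \oo, 0 < V n by exact: cvgr_gt v0.
have lnV : ln (V n) @[n --> \oo] --> ln v.
  by apply: continuous_cvg => //; exact: continuous_ln.
have -> : v `^ q = expR (q * ln v) by rewrite /powR gt_eqF.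
apply: (@cvg_trans _ (expR (q * ln (V n)) @[n --> \oo])).
  by apply: near_eq_cvg; near do rewrite /powR gt_eqF//.
apply: continuous_cvg; first exact: continuous_expR.
by apply: cvgM => //; exact: cvg_cst.
Unshelve. all: by end_near. Qed.

(** * Elementary inequalities *)

Lemma powR_add_le (R : realType) (x y q : R) : 0 <= x -> 0 <= y -> 0 <= q ->
  (x + y) `^ q <= 2 `^ q * (x `^ q + y `^ q).
Proof.
move=> x0 y0 q0; wlog xy : x y x0 y0 / x <= y => [h|].
  have [|yx] := leP x y; first exact: h.
  by rewrite addrC [x `^ q + _]addrC; apply: h => //; exact: ltW.
apply: (@le_trans _ _ ((2 * y) `^ q)).
  by apply: ge0_ler_powR; rewrite ?nnegrE ?addr_ge0 ?mulr_ge0//; lra.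
by rewrite powRM// ler_wpM2l ?powR_ge0// lerDr powR_ge0.
Qed.

Lemma powR_expn (R : realType) (x p : R) n : 0 <= x -> (x ^+ n) `^ p = (x `^ p) ^+ n.
Proof.
move=> x0; elim: n => [|n IH]; first by rewrite !expr0 powR1.
by rewrite !exprS powRM ?exprn_ge0// IH.
Qed.

Lemma sum_rev_geometric_le (R : realType) (s : R) L : 0 <= s < 1 ->
  \sum_(n < L.+1) s ^+ (L - n) <= (1 - s)^-1.
Proof.
move=> /andP[s0 s1]; rewrite (reindex_inj rev_ord_inj)/=.
have -> : \sum_(i < L.+1) s ^+ (L - (L.+1 - i.+1)) = \sum_(i < L.+1) s ^+ i.
  by apply: eq_bigr => i _; rewrite subSS subKn// -ltnS.
rewrite -[leRHS]mul1r ler_pdivlMr ?subr_gt0// mulrC.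
have h := subrX1 s L.+1.
have -> : (1 - s) * \sum_(i < L.+1) s ^+ i = 1 - s ^+ L.+1.
  by rewrite -[1 - s]opprB mulNr -h opprB.
by rewrite gerBl exprn_ge0.
Qed.

Lemma ge0_integral_weighted_sum_le d (Om : measurableType d) (R : realType)
    (mu : {measure set Om -> \bar R}) n (c : nat -> R) (f : nat -> Om -> R) (B : nat -> R) :
  (forall i, 0 <= c i) -> (forall i x, 0 <= f i x) ->
  (forall i, measurable_fun setT (f i)) ->
  (forall i, (i < n)%N -> \int[mu]_x (f i x)%:E <= (B i)%:E)%E ->
  (\int[mu]_x (\sum_(i < n) c i * f i x)%:E <= (\sum_(i < n) c i * B i)%:E)%E.
Proof.
move=> c0 f0 mf fB; under eq_integral do rewrite -sumEFin.
rewrite ge0_integral_sum//=; last 2 first.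
- by move=> i; apply/measurable_EFinP; apply: measurable_funM => //; exact: measurable_cst.
- by move=> i x _; rewrite lee_fin mulr_ge0.
rewrite -sumEFin; apply: lee_sum => i _.
under eq_integral do rewrite EFinM.
rewrite ge0_integralZl//=; last 3 first.
- by apply/measurable_EFinP.
- by move=> x _; rewrite lee_fin.
- by rewrite lee_fin.
by rewrite EFinM; apply: lee_wpmul2l; [rewrite lee_fin|exact: fB].
Qed.

(** The trivial partition already gives a nonnegative sum. *)
Lemma q_variation_ge0 (R : realType) (q a b : R) f : a < b -> (0 <= q_variation q a b f)%E.
Proof.
move=> ab; apply: (@le_trans _ _ (let F := f \o nth b (a :: [:: b]) in
   \sum_(0 <= n < size [:: b]) `|F n.+1 - F n| `^ q)%:E).
  by rewrite lee_fin sumr_ge0// => i _; exact: powR_ge0.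
by apply: ereal_sup_ubound; exists [:: b] => //; exact: itv_partition1.
Qed.

Lemma sup_q_variation_ge0 (R : realType) (q T : R) m (f : R -> R -> R) : 0 < T ->
  (0 <= ereal_sup [set q_variation_I q m (f t) | t in `[0%R, T]])%E.
Proof.
move=> T0; apply: (@le_trans _ _ (q_variation_I q m (f 0))).
  by apply: q_variation_ge0; rewrite gtrN// exprn_gt0.
by apply: ereal_sup_ubound; exists 0 => //=; rewrite in_itv/= lexx ltW.
Qed.

(** * Upcrossings as a function of the level *)

Section variation_of_upcrossings.
Variables (R : realType) (k m : nat).
Local Notation h := (mesh R k).

(** Shifts the levels met in [-2^m, 2^m] to natural numbers. *)
Definition level_offset : nat := (2 ^ (m + k))%N.

Definition level_index (x : R) : nat := absz (level k x + level_offset%:Z).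

Definition scaled_upcrossings (w : path_space R) (t : R) (j : nat) : R :=
  2 * h * (upcrossings k w (j%:Z - level_offset%:Z) t)%:R.

Lemma level_bounds (x : R) : - 2 ^+ m <= x <= 2 ^+ m ->
  - level_offset%:Z <= level k x <= level_offset%:Z.
Proof.
move=> /andP[x1 x2]; have h0 := mesh_gt0 R k.
have hE : 2 ^+ m / h = (level_offset%:Z)%:~R :> R.
  by rewrite /mesh invrK -exprD /level_offset -natrX.
apply/andP; split.
  rewrite -(@intrKceil R (- _)); apply: le_ceil.
  by rewrite rmorphN /= -hE -mulNr ler_pM2r ?invr_gt0.
rewrite -(@intrKceil R (level_offset%:Z)); apply: le_ceil.
by rewrite -hE ler_pM2r ?invr_gt0.
Qed.

Lemma level_indexE (x : R) : - 2 ^+ m <= x <= 2 ^+ m ->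
  (level_index x)%:Z = level k x + level_offset%:Z.
Proof.
move=> /level_bounds /andP[h1 _]; rewrite /level_index gez0_abs//.
by rewrite -lerBlDr sub0r.
Qed.

Lemma norm_upcrossingsE w t (x : R) : - 2 ^+ m <= x <= 2 ^+ m ->
  norm_upcrossings k w t x = scaled_upcrossings w t (level_index x).
Proof. by move=> xm; rewrite /scaled_upcrossings level_indexE// addrK. Qed.

(** The upcrossings are constant between lattice points, so a partition of the
interval induces a nondecreasing chain of levels.  There are [2 ^ (m + k + 1) + 1]
of them, which is where the depth of the chaining comes from. *)
Lemma q_variation_upcrossings_le (q : R) (wt : nat -> R) w t :
  0 < q -> (forall n, 0 < wt n) ->
  let L := (m + k).+1 in
  (q_variation_I q m (norm_upcrossings k w t) <=
   ((2 * \sum_(n < L.+1) (wt n)^-1 `^ q^-1) `^ q *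
    dyadic_energy L (scaled_upcrossings w t) wt q 0 (2 ^ L))%:E)%E.
Proof.
move=> q0 wt0 /=; set L := (m + k).+1; apply: ge_ereal_sup => _ [s sp <-]; rewrite lee_fin.
set a := - 2 ^+ m in sp *; set b := 2 ^+ m in sp *.
have inI l : (l <= size s)%N -> a <= nth b (a :: s) l <= b.
  by move=> ls; rewrite itv_partition_nth_ge//= itv_partition_nth_le.
pose x l := level_index (nth b (a :: s) l).
rewrite [leLHS](_ : _ = \sum_(0 <= n < size s)
    `|scaled_upcrossings w t (x n.+1) - scaled_upcrossings w t (x n)| `^ q); last first.
  cbv zeta; rewrite big_nat [RHS]big_nat; apply: eq_bigr => l /andP[_ ls].
  have := norm_upcrossingsE w t (inI _ ls).
  by have := norm_upcrossingsE w t (inI _ (ltnW ls)) => /= -> ->.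
apply: chain_variation_le => //.
- move=> l ls; rewrite -lez_nat !level_indexE; [|exact: (inI l.+1)|exact: (inI l (ltnW ls))].
  rewrite lerD2r; apply: le_ceil; rewrite ler_pM2r ?invr_gt0 ?mesh_gt0//.
  case: sp => + _ => /(pathP b) /(_ l ls) /ltW; exact.
- rewrite -lez_nat level_indexE; last exact: (inI (size s)).
  have /andP[_] := level_bounds (inI _ (leqnn (size s))).
  by rewrite /L expnS /level_offset; lia.
Qed.

End variation_of_upcrossings.

(** * Moments of the increments between two levels *)

Lemma measurable_increment_bound d (Om : measurableType d) (R : realType)
    (c q : R) (A M : Om -> R) :
  measurable_fun setT A -> measurable_fun setT M ->
  measurable_fun setT (fun w => (2 * Num.sqrt (c * A w) + 2 * M w) `^ q).
Proof.
move=> mA mM; apply: (measurableT_comp (measurable_powR _)).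
apply: measurable_funD; apply: measurable_funM => //; try exact: measurable_cst.
apply: (measurableT_comp (f := @Num.sqrt R)).
  by apply: continuous_measurable_fun; exact: sqrt_continuous.
by apply: measurable_funM => //; exact: measurable_cst.
Qed.

(** The scaling that makes chaining work: [E |U_b - U_a|^q] is of order
[lam ^ (q / 2)] with [lam] the distance of the levels.  Once the grid is fine
enough, the bounds on both terms are homogeneous of this degree. *)
Lemma increment_moment (R : realType) (q : R) : 0 < q -> exists2 C : R, 0 < C &
  forall (T : R) (P : probability (path_space R) R) k N (a b : int),
    0 < T -> wiener_measure P -> a < b -> T / 2 ^+ N <= mesh R k * Num.sqrt T ->
    (\int[P]_w ((2 * Num.sqrt ((b - a)%:~R * mesh R k *
           running_max T N (fun=> setT) (2 ^ N) w) +
         2 * running_max T N (between_sites T k N a b) (2 ^ N) w) `^ q)%:E <=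
     (C * ((b - a)%:~R * mesh R k) `^ (q / 2) * T `^ (q / 4))%:E)%E.
Proof.
move=> q0; have q2 : 0 <= q / 2 by rewrite divr_ge0// ltW.
have [C1 C10 hC1] := displacement_moment q2.
have [C2 C20 hC2] := strip_moment (ltW q0).
exists (2 `^ q * 2 `^ q * (C1 + C2 * 2 `^ (q / 2))) => [|T P k N a b T0 wP ab dtN].
  by rewrite !mulr_gt0 ?powR_gt0// addr_gt0// mulr_gt0// powR_gt0.
set h := mesh R k; have h0 : 0 < h by exact: mesh_gt0.
set lam := (b - a)%:~R * h.
have lam0 : 0 < lam by rewrite mulr_gt0// ltr0z subr_gt0.
have lamh : h <= lam by rewrite ler_peMl ?(ltW h0)// ler1z; lia.
set A := running_max T N (fun=> setT) (2 ^ N).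
set M := running_max T N (between_sites T k N a b) (2 ^ N).
have A0 w : 0 <= A w by exact: running_max_ge0.
have M0 w : 0 <= M w by exact: running_max_ge0.
have aB : adapted T N (between_sites T k N a b) by exact: adapted_between_sites.
have mA : measurable_fun setT A by exact: measurable_running_max.
have mM : measurable_fun setT M by exact: measurable_running_max.
have mAp : measurable_fun setT (fun w => A w `^ (q / 2)) by exact: (measurableT_comp (measurable_powR _) mA).
have mMp : measurable_fun setT (fun w => M w `^ q) by exact: (measurableT_comp (measurable_powR _) mM).
pose D := 2 `^ q * 2 `^ q; have D0 : 0 < D by rewrite mulr_gt0// powR_gt0.
have ptw w : (2 * Num.sqrt (lam * A w) + 2 * M w) `^ q <=
    D * (lam `^ (q / 2) * A w `^ (q / 2) + M w `^ q).
  apply: le_trans (powR_add_le _ _ (ltW q0)) _.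
  - by rewrite mulr_ge0// sqrtr_ge0.
  - by rewrite mulr_ge0.
  have lA : 0 <= lam * A w by rewrite mulr_ge0// ltW.
  rewrite (powRM q (ler0n _ 2) (sqrtr_ge0 _)) (powRM q (ler0n _ 2) (M0 w)) -mulrDr mulrA.
  by rewrite -(powR12_sqrt lA) -powRrM (powRM _ (ltW lam0) (A0 w)) [2^-1 * q]mulrC.
apply: (@le_trans _ _ (\int[P]_w (D%:E * ((lam `^ (q / 2))%:E * (A w `^ (q / 2))%:E + (M w `^ q)%:E)))%E).
  apply: ge0_le_integral => //=.
  - by move=> w _; rewrite lee_fin powR_ge0.
  - by apply/measurable_EFinP; exact: measurable_increment_bound.
  - apply: emeasurable_funM; first exact: measurable_cst.
    apply: emeasurable_funD; last by apply/measurable_EFinP.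
    by apply: emeasurable_funM; [exact: measurable_cst|apply/measurable_EFinP].
  - by move=> w _; have := ptw w; rewrite -lee_fin EFinM EFinD EFinM.
rewrite ge0_integralZl//=; last 3 first.
- apply: emeasurable_funD; last by apply/measurable_EFinP.
  by apply: emeasurable_funM; [exact: measurable_cst|apply/measurable_EFinP].
- by move=> w _; rewrite adde_ge0// ?mule_ge0// lee_fin powR_ge0.
- by rewrite lee_fin ltW.
rewrite ge0_integralD//=; last 4 first.
- by move=> w _; rewrite mule_ge0// lee_fin powR_ge0.
- by apply: emeasurable_funM; [exact: measurable_cst|apply/measurable_EFinP].
- by move=> w _; rewrite lee_fin powR_ge0.
- by apply/measurable_EFinP.
rewrite ge0_integralZl//=; last 3 first.
- by apply/measurable_EFinP.
- by move=> w _; rewrite lee_fin powR_ge0.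
- by rewrite lee_fin powR_ge0.
rewrite [leRHS](_ : _ = D%:E * ((C1 + C2 * 2 `^ (q / 2)) * lam `^ (q / 2) * T `^ (q / 4))%:E)%E;
  last by rewrite -EFinM !mulrA.
apply: lee_wpmul2l; first by rewrite lee_fin ltW.
have hA := hC1 T P N T0 wP; rewrite -/A in hA.
have q4 : q / 2 / 2 = q / 4 by field.
rewrite q4 in hA.
have strip i : between_sites T k N a b i `<=` in_strip T N (a%:~R * h) ((b + 1)%:~R * h) i.
  exact: between_sites_strip.
have wid : (b + 1)%:~R * h - a%:~R * h = lam + h.
  by rewrite intrD /lam intrB !mulrDl mul1r mulNr; ring.
have ab' : a%:~R * h < (b + 1)%:~R * h by rewrite -subr_gt0 wid addr_gt0.
have hM := hC2 T P N _ _ _ T0 wP aB ab' strip.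
rewrite -/M wid in hM.
have {}hM := hM _.
have dtN' : T / 2 ^+ N <= (lam + h) * Num.sqrt T.
  by apply: le_trans dtN _; rewrite ler_wpM2r ?sqrtr_ge0// lerDr ltW.
have {}hM := hM dtN'.
apply: (@le_trans _ _ ((lam `^ (q / 2))%:E * (C1 * T `^ (q / 4))%:E +
    (C2 * ((lam + h) * Num.sqrt T) `^ (q / 2))%:E)%E).
  by apply: leeD => //; apply: lee_wpmul2l => //; rewrite lee_fin powR_ge0.
rewrite -EFinM -EFinD lee_fin.
have sT : Num.sqrt T `^ (q / 2) = T `^ (q / 4).
  by rewrite -(powR12_sqrt (ltW T0)) -powRrM; congr (_ `^ _); field.
have le1 : ((lam + h) * Num.sqrt T) `^ (q / 2) <= 2 `^ (q / 2) * lam `^ (q / 2) * T `^ (q / 4).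
  rewrite -sT -powRM// ?(ltW lam0)// -powRM// ?sqrtr_ge0//; last by rewrite mulr_ge0// ltW.
  apply: ge0_ler_powR; rewrite ?nnegrE//.
  - by rewrite mulr_ge0 ?sqrtr_ge0// addr_ge0// ltW.
  - by rewrite mulr_ge0 ?sqrtr_ge0// mulr_ge0// ltW.
  - by rewrite ler_wpM2r ?sqrtr_ge0//; lra.
have := ler_wpM2l (ltW C20) le1.
by move: (lam `^ _) (T `^ _) (_ `^ (q / 2)) (2 `^ (q / 2)) => u v x y; lra.
Qed.

Lemma powR2N_lt1 (R : realType) (x : R) : 0 < x -> 2 `^ (- x) < 1 :> R.
Proof.
move=> x0; rewrite /powR ifN ?gt_eqF// -[ltRHS]expR0 ltr_expR mulNr oppr_lt0.
by rewrite mulr_gt0// ln_gt0// ltr1n.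
Qed.

(** * Moments of the variation *)

(** Blocks of length [2 ^ n] get the weight [2 ^ (delta * (L - n) / 4)] up to a
constant.  It grows, so the constant of the chaining is a convergent geometric
sum; but it grows slowly enough: there are [2 ^ (L - n)] such blocks, of expected
energy [2 ^ (- (1 + delta / 2) * (L - n))] each, so the total still decays like
[2 ^ (- (delta / 4) * (L - n))].  Both sums are bounded uniformly in the depth. *)
Lemma dyadic_weights (R : realType) (delta : R) : 0 < delta ->
  exists (wt : nat -> nat -> R) (K : R), [/\ 0 < K, forall L n, 0 < wt L n,
    forall L, (2 * \sum_(n < L.+1) (wt L n)^-1 `^ (2 + delta)^-1) `^ (2 + delta) <= 1 &
    forall L, \sum_(n < L.+1) wt L n *
      ((2 ^ (L - n))%:R * ((2^-1) ^+ (L - n)) `^ ((2 + delta) / 2)) <= K].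
Proof.
move=> d0; set q := 2 + delta; have q0 : 0 < q by rewrite /q; lra.
have qn0 : q != 0 by rewrite gt_eqF.
pose s : R := 2 `^ (- (delta / 4 / q)).
have s1 : s < 1 by apply: powR2N_lt1; rewrite !divr_gt0.
have s0 : 0 < s by rewrite powR_gt0.
pose rho : R := 2 `^ (- (delta / 4)).
have rho1 : rho < 1 by apply: powR2N_lt1; rewrite !divr_gt0.
have rho0 : 0 < rho by rewrite powR_gt0.
pose c := (1 - s) / 2; have c0 : 0 < c by rewrite divr_gt0// subr_gt0.
have cs0 L n : 0 < c * s ^+ (L - n) by rewrite mulr_gt0// exprn_gt0.
exists (fun L n => (c * s ^+ (L - n))^-1 `^ q), (c^-1 `^ q * (1 - rho)^-1); split.
- by rewrite mulr_gt0 ?powR_gt0 ?invr_gt0// subr_gt0.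
- by move=> L n; rewrite powR_gt0// invr_gt0.
- move=> L; have -> : \sum_(n < L.+1) ((c * s ^+ (L - n))^-1 `^ q)^-1 `^ q^-1 =
      c * \sum_(n < L.+1) s ^+ (L - n).
    rewrite mulr_sumr; apply: eq_bigr => n _.
    rewrite -(powR_inv1 (ltW (cs0 L n))) -powRrM -powRN -powRrM mulN1r opprK mulfV//.
    by rewrite powRr1// ltW.
  have le1 : 2 * (c * \sum_(n < L.+1) s ^+ (L - n)) <= 1.
    have := @sum_rev_geometric_le R s L; rewrite (ltW s0) s1 => /(_ isT) hs.
    rewrite mulrA (_ : 2 * c = 1 - s); last by rewrite /c; field.
    by rewrite mulrC -ler_pdivlMr ?subr_gt0// mul1r.
  apply: (@le_trans _ _ (1 `^ q)); last by rewrite powR1.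
  apply: ge0_ler_powR; rewrite ?nnegrE ?(ltW q0)//.
  rewrite mulr_ge0// mulr_ge0 ?(ltW c0)// sumr_ge0// => i _.
    by rewrite exprn_ge0// ltW.
- move=> L.
  have termE n : (c * s ^+ (L - n))^-1 `^ q *
      ((2 ^ (L - n))%:R * ((2^-1) ^+ (L - n)) `^ (q / 2)) = c^-1 `^ q * rho ^+ (L - n).
    have [p pE] : exists p, p = q / 2 by eexists.
    rewrite -pE invfM powRM ?invr_ge0 ?exprn_ge0// ?(ltW s0) ?(ltW c0)// -mulrA; congr (_ * _).
    rewrite -exprVn !powR_expn ?invr_ge0// ?(ltW s0)// natrX -!exprMn; congr (_ ^+ _).
    rewrite -(powR_inv1 (ltW s0)) -(@powR_inv1 _ 2)// -!powRrM -[X in _ * (X * _)]powRr1//.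
    rewrite -!powRD; [|by rewrite pnatr_eq0 implybT..].
    by rewrite /rho; congr (_ `^ _); rewrite pE /q; field; rewrite -/q qn0.
  under eq_bigr do rewrite termE.
  rewrite -mulr_sumr ler_wpM2l ?powR_ge0//.
  by apply: sum_rev_geometric_le; rewrite (ltW rho0).
Qed.

Section variation_moment.
Variables (R : realType) (k m : nat) (T q : R) (wt : nat -> R).
Hypotheses (T0 : 0 < T) (q1 : 1 <= q) (wt0 : forall n, 0 < wt n).
Local Notation h := (mesh R k).
Local Notation L := (m + k).+1.

Definition increment_bound N (a b : int) (w : path_space R) : R :=
  (2 * Num.sqrt ((b - a)%:~R * h * running_max T N (fun=> setT) (2 ^ N) w) +
   2 * running_max T N (between_sites T k N a b) (2 ^ N) w) `^ q.

(** Upcrossings to a level [j] are counted from [j - 1], hence the shift by one. *)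
Definition dyadic_level (n i : nat) : int := (2 ^ n * i)%N%:Z - (level_offset k m)%:Z - 1.

(** Replaces the increments in the dyadic energy by measurable bounds that do not
depend on [t]. *)
Definition energy_bound N (w : path_space R) : R :=
  \sum_(n < L.+1) wt n * \sum_(i < 2 ^ (L - n))
    increment_bound N (dyadic_level n i) (dyadic_level n i.+1) w.

Lemma measurable_increment_bound_max N a b : measurable_fun setT (increment_bound N a b).
Proof.
apply: measurable_increment_bound; apply: measurable_running_max => //.
exact: adapted_between_sites.
Qed.

Lemma measurable_energy_bound N : measurable_fun setT (energy_bound N).
Proof.
apply: measurable_sum => n; apply: measurable_funM; first exact: measurable_cst.
by apply: measurable_sum => i; exact: measurable_increment_bound_max.
Qed.

Lemma energy_bound_ge0 N w : 0 <= energy_bound N w.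
Proof.
rewrite /energy_bound sumr_ge0// => n _; rewrite mulr_ge0 ?(ltW (wt0 _))// sumr_ge0// => i _.
exact: powR_ge0.
Qed.

(** The energy involves finitely many blocks, so the approximations of their
increments converge together. *)
Lemma dyadic_energy_le_limn_einf w t : brownian w 0 = 0 -> 0 <= t <= T ->
  ((dyadic_energy L (scaled_upcrossings k m w t) wt q 0 (2 ^ L))%:E <=
   limn_einf (fun N => (energy_bound N w)%:E))%E.
Proof.
move=> w0 tT; have q0 : 0 < q by exact: lt_le_trans q1.
pose v := scaled_upcrossings k m w t.
have step n i : exists Vl : (nat -> R) * R, [/\ forall N, 0 <= Vl.1 N, Vl.1 @ \oo --> Vl.2,
    `|v (2 ^ n * i.+1)%N - v (2 ^ n * i)%N| <= Vl.2 & forall N, Vl.1 N `^ q <=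
      increment_bound N (dyadic_level n i) (dyadic_level n i.+1) w].
  have le : dyadic_level n i <= dyadic_level n i.+1.
    by rewrite /dyadic_level !lerD2r lez_nat leq_mul2l leqnSn orbT.
  have [V [l [V0 Vl vl VM]]] := @upcrossings_increment_lim R T T0 k w w0 t _ _ tT le.
  exists (V, l); split => //=; first by move: vl; rewrite /dyadic_level !subrK.
  move=> N; apply: ge0_ler_powR; rewrite ?nnegrE ?(ltW q0)//.
  exact: le_trans (VM N).
pose V n := projT1 (choice (step n)).
have hV n i := projT2 (choice (step n)) i; rewrite -/(V _) in hV.
pose c N := \sum_(n < L.+1) wt n * \sum_(i < 2 ^ (L - n)) (V n i).1 N `^ q.
have cc : (c N)%:E @[N --> \oo] -->
    (\sum_(n < L.+1) wt n * \sum_(i < 2 ^ (L - n)) (V n i).2 `^ q)%:E.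
  apply: cvg_EFin; first by near=> N.
  apply: (@cvg_sum_ord R L.+1 (fun N n => wt n * \sum_(i < 2 ^ (L - n)) (V n i).1 N `^ q)
    (fun n => wt n * \sum_(i < 2 ^ (L - n)) (V n i).2 `^ q)) => n.
  apply: cvgM; first exact: cvg_cst.
  apply: (@cvg_sum_ord R _ (fun N i => (V n i).1 N `^ q) (fun i => (V n i).2 `^ q)) => i.
  by have [V0 Vl _ _] := hV n i; exact: cvg_powR.
apply: le_trans (cvg_le_limn_einf cc _) => [|N]; rewrite lee_fin.
  apply: ler_sum => n _; apply: ler_wpM2l; first exact: ltW.
  apply: ler_sum => i _; have [V0 Vl vl _] := hV n i.
  apply: (@le_trans _ _ (`|v (2 ^ n * i.+1)%N - v (2 ^ n * i)%N| `^ q)).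
    by rewrite ler_piMl ?powR_ge0// lern1 leq_b1.
  apply: ge0_ler_powR; rewrite ?nnegrE ?(ltW q0)//.
  exact: le_trans vl.
apply: ler_sum => n _; apply: ler_wpM2l; first exact: ltW.
by apply: ler_sum => i _; have [] := hV n i.
Unshelve. all: by end_near. Qed.

Hypothesis wt1 : (2 * \sum_(n < L.+1) (wt n)^-1 `^ q^-1) `^ q <= 1.

Lemma sup_variation_le_limn_einf w : brownian w 0 = 0 ->
  (ereal_sup [set q_variation_I q m (norm_upcrossings k w t) | t in `[0%R, T]] <=
   limn_einf (fun N => (energy_bound N w)%:E))%E.
Proof.
move=> w0; apply: ge_ereal_sup => _ [t /= tT <-].
have {}tT : 0 <= t <= T by rewrite in_itv/= in tT.
have q0 : 0 < q by exact: lt_le_trans q1.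
apply: le_trans (q_variation_upcrossings_le k m w t q0 wt0) _.
apply: le_trans (dyadic_energy_le_limn_einf w0 tT).
by rewrite lee_fin ler_piMl// dyadic_energy_ge0// => n; exact: ltW.
Qed.

(** The distance of the end points of a block of length [2 ^ n] is
[2 ^ n * mesh = 2 ^ (m + 1) * 2 ^ (n - L)].  The dependence on [k] is thereby
absorbed in the depth [L]. *)
Lemma integral_energy_bound (P : probability (path_space R) R) (C : R) N :
  (forall a b : int, (a < b)%R -> \int[P]_w (increment_bound N a b w)%:E <=
     (C * ((b - a)%:~R * h) `^ (q / 2) * T `^ (q / 4))%:E)%E ->
  (\int[P]_w (energy_bound N w)%:E <=
   (C * (2 ^+ m.+1) `^ (q / 2) * T `^ (q / 4) * \sum_(n < L.+1) wt n *
      ((2 ^ (L - n))%:R * ((2^-1) ^+ (L - n)) `^ (q / 2)))%:E)%E.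
Proof.
move=> hC.
pose B n := \sum_(i < 2 ^ (L - n)) C * ((2 ^ n)%:R * h) `^ (q / 2) * T `^ (q / 4).
have hB n : (n < L.+1)%N -> (\int[P]_w (\sum_(i < 2 ^ (L - n))
    increment_bound N (dyadic_level n i) (dyadic_level n i.+1) w)%:E <= (B n)%:E)%E.
  move=> _.
  have := @ge0_integral_weighted_sum_le _ _ R P (2 ^ (L - n)) (fun=> 1)
    (fun i => increment_bound N (dyadic_level n i) (dyadic_level n i.+1))
    (fun=> C * ((2 ^ n)%:R * h) `^ (q / 2) * T `^ (q / 4)) (fun=> ler01)
    (fun i w => powR_ge0 _ _) (fun i => measurable_increment_bound_max N _ _).
  under eq_integral do under eq_bigr do rewrite mul1r.
  under eq_bigr do rewrite mul1r.
  apply => i _.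
  have wid : dyadic_level n i.+1 - dyadic_level n i = (2 ^ n)%N%:Z.
    by rewrite /dyadic_level mulnS PoszD; ring.
  rewrite -[X in (X * h)]/((2 ^ n)%N%:Z%:~R) -wid; apply: hC.
  by rewrite -subr_gt0 wid ltz_nat expn_gt0.
have := @ge0_integral_weighted_sum_le _ _ R P L.+1 wt (fun n w => \sum_(i < 2 ^ (L - n))
    increment_bound N (dyadic_level n i) (dyadic_level n i.+1) w) B
    (fun n => ltW (wt0 n)) _ _ hB.
move=> /(_ _ _)/le_trans; apply.
- by move=> n w; rewrite sumr_ge0// => i _; exact: powR_ge0.
- by move=> n; apply: measurable_sum => i; exact: measurable_increment_bound_max.
rewrite lee_fin mulr_sumr; apply: ler_sum => n _.
have nL : (n <= L)%N by rewrite -ltnS.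
have -> : B n = C * (2 ^+ m.+1) `^ (q / 2) * T `^ (q / 4) *
    ((2 ^ (L - n))%:R * ((2^-1) ^+ (L - n)) `^ (q / 2)).
  rewrite /B sumr_const card_ord -[_ *+ (2 ^ (L - n))]mulr_natr.
  have -> : (2 ^ n)%:R * h = 2 ^+ m.+1 * (2^-1) ^+ (L - n) :> R.
    rewrite natrX /mesh exprVn; apply/eqP; rewrite eqr_div ?expf_neq0//.
    by rewrite -!exprD subnKC// addSn.
  by rewrite powRM// ?exprn_ge0// ?invr_ge0//; ring.
by rewrite mulrCA.
Qed.

End variation_moment.

(** Fatou's lemma for the bounds on finer and finer grids.  For each fixed [k] the
moment bound applies from some grid on, with a constant independent of [k]. *)
Lemma upcrossing_variation_moment (R : realType) (delta : R) (m : nat) : 0 < delta ->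
  exists2 C : R, 0 < C &
    forall (P : probability (path_space R) R) (T : R) k, wiener_measure P -> 0 < T ->
    (\int[P]_w ereal_sup [set q_variation_I (2 + delta) m (norm_upcrossings k w t)
                         | t in `[0%R, T]]
     <= (C * T `^ (2^-1 + delta / 4))%:E)%E.
Proof.
move=> d0; set q := 2 + delta; have q0 : 0 < q by rewrite /q; lra.
have q1 : 1 <= q by rewrite /q; lra.
have [C1 C10 hC1] := increment_moment q0.
have [wt [K [K0 wt0 wt1 wtK]]] := dyadic_weights d0.
exists (C1 * (2 ^+ m.+1) `^ (q / 2) * K) => [|P T k wP T0].
  by rewrite !mulr_gt0// powR_gt0// exprn_gt0.
set L := (m + k).+1.
pose eb := energy_bound k m T q (wt L).
pose good := [set w : path_space R | brownian w 0 = 0].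
have mgood : measurable good.
  have -> : good = (fun w : path_space R => brownian w 0) @^-1` [set 0] by [].
  by rewrite -[X in measurable X]setTI; apply: measurable_brownian.
(* The pathwise bound holds for paths starting at 0; on the others, a null set,
   the infinite value makes it trivial. *)
pose g N (w : path_space R) : \bar R := if brownian w 0 == 0 then (eb N w)%:E else +oo%E.
have mEB N : measurable_fun setT (fun w => (eb N w)%:E).
  by apply/measurable_EFinP; exact: measurable_energy_bound.
have eb0 N w : (0 <= (eb N w)%:E)%E by rewrite lee_fin energy_bound_ge0.
have g0 N w : (0 <= g N w)%E by rewrite /g; case: ifP.
have mg N : measurable_fun setT (g N).
  apply: measurable_fun_ifT => //.
    apply: (measurable_fun_bool true); rewrite setTI.
    rewrite (_ : _ @^-1` _ = good)//.
    by apply/seteqP; split => w /= => /eqP.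
have aeg N : (\int[P]_w g N w = \int[P]_w (eb N w)%:E)%E.
  apply: ge0_ae_eq_integral => //.
  exists (~` good); split; first exact: measurableC.
    have := probability_setC P mgood; case: (wP) => PE _; rewrite [X in (_ - X)%E]PE subee//.

  by move=> w /= /not_implyP[_ h] /= w0; apply: h; rewrite /g w0 eqxx.
apply: (@le_trans _ _ (\int[P]_w limn_einf (g^~ w))%E).
  apply: ge0_le_lower_integral => w; first exact: sup_q_variation_ge0.
  have [w0|w0] := eqVneq (brownian w 0) 0.
    rewrite (_ : g^~ w = fun N => (eb N w)%:E); last first.
      by apply/funext => N; rewrite /g w0 eqxx.
    by apply: sup_variation_le_limn_einf.
  rewrite (_ : g^~ w = fun=> +oo%E); last by apply/funext => N; rewrite /g (negbTE w0).
  apply: le_trans (cvg_le_limn_einf (l := +oo%E) (u := fun=> +oo%E) _ _) => //.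
    exact: leey.
  exact: cvg_cst.
apply: le_trans (fatou P measurableT mg (fun N w _ => g0 N w)) _.
have small : \forall N \near \oo, T / 2 ^+ N < mesh R k * Num.sqrt T.
  by apply: cvgr_lt (cvg_mesh_size T) _ _; rewrite mulr_gt0 ?mesh_gt0 ?sqrtr_gt0.
case: small => N0 _ small.
apply: (limn_einf_le (N0 := N0)) => N NN0; rewrite aeg.
have IE := @integral_energy_bound R k m T q (wt L) T0 (wt0 L) P C1 N.
apply: le_trans (IE _) _.
  by move=> a b ab; apply: hC1 => //; apply: ltW; exact: small.
rewrite lee_fin (_ : 2^-1 + delta / 4 = q / 4); last by rewrite /q; field.
rewrite [leRHS]mulrAC; apply: ler_wpM2l.
  by rewrite !mulr_ge0 ?powR_ge0// ltW.
exact: wtK.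
Qed.

Theorem corollary2p1 (R : realType) (delta : R) (m : nat)
    (delta_gt0 : 0 < delta) (m_ge1 : (1 <= m)%N) :
  exists2 C : R, 0 < C &
    forall (P : probability (path_space R) R)
      (l : path_space R -> R -> R -> R) (T : R),
    wiener_measure P -> local_time P l -> 0 < T ->
    (ereal_sup
      [set \int[P]_w
             ereal_sup [set q_variation_I (2 + delta) m (norm_upcrossings k w t)
                       | t in `[0%R, T]]
      | k in [set k : nat | (1 <= k)%N]]
    <= \int[P]_w
         ereal_sup [set q_variation_I (2 + delta) m (fun x => l w x t)
                   | t in `[0%R, T]]
       + (C * T `^ (2^-1 + delta / 4))%:E)%E.
Proof.
have [C C0 hC] := upcrossing_variation_moment m delta_gt0.
exists C => // P l T wP _ T0; apply: ge_ereal_sup => _ [k _ <-].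
apply: le_trans (hC P T k wP T0) _; apply: leeDr.
by apply: integral_ge0 => w _; exact: (sup_q_variation_ge0 _ _ (fun t x => l w x t)).
Qed.
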